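(* For every $\varepsilon>0$, there exists only one (up to translation in $x$) smooth positive solitary wave solution $u_\varepsilon$ of the second-order equation $$u_\varepsilon''=\frac{u_\varepsilon(1-u_\varepsilon^2)}{(1-u_\varepsilon^2)^2+\varepsilon^2}$$ such that $0<u_\varepsilon(x)\le\sqrt2$. Moreover, if $u_\varepsilon$ is translated so that its maximum is at $x=0$, then $$\|u_\varepsilon-u_{\rm bell}\|_{H^1(\mathbb{R})}\to0\quad\text{as }\varepsilon\to0,$$ where $u_{\rm bell}$ is the bell-shaped soliton defined in the context.
   Context: A solitary wave solution is a solution on $\mathbb{R}$ with $u(x)\to0$ as $|x|\to\infty$. Cusped soliton $u_{\rm cusp}$: $u_{\rm cusp}(0)=1$ and for $x\ne0$, $u=u_{\rm cusp}(x)\in(0,1)$ is defined by $|x|=\int_u^1\frac{d\xi}{\sqrt{-\log(1-\xi^2)}}$. Bell-shaped soliton: let $\ell:=\int_1^{\sqrt2}\frac{du}{\sqrt{|\log(u^2-1)|}}$ and define $$u_{\rm bell}(x)=\begin{cases}u_{\rm head}(x),&x\in[-\ell,\ell],\\ u_{\rm cusp}(|x|-\ell),&|x|>\ell,\end{cases}$$ where $u=u_{\rm head}(x)\in[1,\sqrt2]$ is defined for $x\in[-\ell,\ell]$ by $\ell-|x|=\int_1^u\frac{d\xi}{\sqrt{-\log(\xi^2-1)}}$ (so $u_{\rm head}(\pm\ell)=1$, $u_{\rm head}(0)=\sqrt2$). *)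

(* Defs.v *)
From HB Require Import structures.
From mathcomp Require Import all_boot all_order all_algebra.
From mathcomp Require Import all_classical all_reals all_analysis.
Set Implicit Arguments.
Unset Strict Implicit.
Unset Printing Implicit Defensive.
Import Order.TTheory GRing.Theory Num.Theory.
Import numFieldNormedType.Exports.
Local Open Scope classical_set_scope.
Local Open Scope ring_scope.

Definition smooth (R : realType) (f : R -> R) : Prop :=
  forall (n : nat) (x : R), derivable (f^`(n))%classic x 1.

Definition test_function (R : realType) (phi : R -> R) : Prop :=
  smooth phi /\ compact (closure [set x | phi x != 0]).

Definition weak_derivative (R : realType) (f g : R -> R) : Prop :=
  [/\ locally_integrable setT f, locally_integrable setT g
    & forall phi : R -> R, test_function phi ->
        \int[lebesgue_measure]_x (f x * phi^`()%classic x)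
        = - \int[lebesgue_measure]_x (g x * phi x)].

(* The weak derivative being unique up to a null set, the infimum below ranges
   over at most one value.  It is +oo exactly when f is not in H^1(R): either f
   has no weak derivative, or f or its weak derivative is not in L^2(R). *)
Definition H1_norm (R : realType) (f : R -> R) : \bar R :=
  ereal_inf [set sqrte (\int[lebesgue_measure]_x ((f x) ^+ 2)%:E
                        + \int[lebesgue_measure]_x ((g x) ^+ 2)%:E)%E
            | g in weak_derivative f].

Definition solitary_wave (R : realType) (eps : R) (u : R -> R) : Prop :=
  [/\ smooth u,
      forall x, u^`(2)%classic x =
        u x * (1 - u x ^+ 2) / ((1 - u x ^+ 2) ^+ 2 + eps ^+ 2),
      u x @[x --> +oo] --> (0 : R),
      u x @[x --> -oo] --> (0 : R)
    & forall x, 0 < u x <= Num.sqrt 2].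

(* The conventions ln 0 = 0 and 0^-1 = 0 only affect the integrands below at
   the endpoints 1 and sqrt 2.  The equations characterizing the profiles are
   stated in \bar R, where the integral of a nonnegative function needs no
   integrability condition; each has exactly one solution on the domain of the
   corresponding profile, so the default value 0 of xget is irrelevant there. *)
Definition cusped_soliton (R : realType) (x : R) : R :=
  if x == 0 then 1 else
  xget 0 [set u | 0 < u < 1 /\
    (`|x|%:E = \int[lebesgue_measure]_(xi in `[u, 1%R])
                 ((Num.sqrt (- ln (1 - xi ^+ 2)))^-1)%:E)%E].

Definition bell_halfwidth (R : realType) : R :=
  \int[lebesgue_measure]_(u in `[1, Num.sqrt 2])
    (Num.sqrt `|ln (u ^+ 2 - 1)|)^-1.

Definition bell_head (R : realType) (x : R) : R :=
  xget 0 [set u | 1 <= u <= Num.sqrt 2 /\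
    ((bell_halfwidth R - `|x|)%:E =
       \int[lebesgue_measure]_(xi in `[1%R, u])
         ((Num.sqrt (- ln (xi ^+ 2 - 1)))^-1)%:E)%E].

Definition bell_soliton (R : realType) (x : R) : R :=
  if `|x| <= bell_halfwidth R then bell_head x
  else cusped_soliton (`|x| - bell_halfwidth R).

(* Main.v *)
Require Import Defs.
From HB Require Import structures.
From mathcomp Require Import all_boot all_order all_algebra.
From mathcomp Require Import all_classical all_reals all_analysis.
From mathcomp Require Import measurable_realfun ring lra.
Import Order.TTheory GRing.Theory Num.Theory.
Import numFieldNormedType.Exports.
Local Open Scope classical_set_scope.
Local Open Scope ring_scope.

(** Multiplying the equation by [u'] yields the first integral
    [u' ^ 2 = P(u)], where [P u = - ln (((1 - u^2)^2 + eps^2) / (1 + eps^2)) / 2].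
    A solitary wave has maximum [sqrt 2], the only positive zero of [P], so it is
    determined by its Cauchy data at the maximum.

    The substitution [u = sqrt 2 / cosh t] turns the first integral into
    [dx / dt = stretch eps t], whose right-hand side is continuous and nonnegative
    for every [eps], including [eps = 0], where it vanishes exactly when [u = 1]
    (the points of infinite slope of the bell soliton).  Inverting [x(t)] gives the
    wave [u_eps], and [eps = 0] gives the bell soliton.

    As [eps -> 0], [x_eps(t) -> x_0(t)], hence [u_eps -> u_0] pointwise, and in L^2
    by domination.  For the derivatives, which have the same sign,
    [(u_eps' - u_0')^2 <= |u_eps'^2 - u_0'^2|], and Scheffe's argument applies
    because the integral of [u_eps'^2] is twice that of [sqrt P_eps] over
    [[0, sqrt 2]], which is at most its value for [eps = 0]. *)

(** * Fundamental theorem of calculus with exceptional points *)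

(** The obstacle is that the quadrature [dx = du / sqrt P] is singular at the maximum, where [P]
    vanishes, and that for [eps = 0] the slope is infinite where [u = 1]. The curve
    [sqrt 2 / cosh t] is the homoclinic orbit of [u'' = u - u^3], so along it [2 * (du/dt)^2 = u^2 *
    (2 - u^2) = 1 - (1 - u^2)^2]. With [z] this quantity divided by [1 + eps^2], one has
    [2 * P = - ln (1 - z)], hence [(dx/dt)^2 = (1 + eps^2) * z / (- ln (1 - z))]: a bounded function
    whose singularities at [z = 0] and [z = 1] are removable. One increasing homeomorphism [x(t)]
    thus describes the whole wave, with bounds uniform for bounded [eps]. Uniqueness goes back to
    the second-order equation, because the first integral alone also admits the constant [sqrt 2].
    The logarithmic peak of [u_eps'^2] sits where [u_eps = 1], a point depending on [eps], so no
    dominating function is at hand for the derivatives. A bound on the total integral replaces it;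
    it comes from [P_eps <= P_0] off [u = 1], once [u] is the integration variable. *)

Section calculus.
Context {R : realType}.
Implicit Types (f F g : R -> R) (a b x : R).
Notation mu := (@lebesgue_measure R).

Lemma is_derive_continuous f x d : is_derive x 1 f d -> {for x, continuous f}.
Proof. by move=> [df _]; exact/differentiable_continuous/derivable1_diffP. Qed.

Lemma le_of_derive_ge0 f df a b : a <= b ->
  (forall x, a < x < b -> is_derive x 1 f (df x)) ->
  (forall x, a < x < b -> 0 <= df x) ->
  {within `[a, b], continuous f} -> f a <= f b.
Proof.
rewrite le_eqVlt => /predU1P[-> //|ab] dfx df0 cf.
have [c cab h] : exists2 c, c \in `]a, b[%R & f b - f a = df c * (b - a).
  by apply: MVT => // x xab; apply: dfx; rewrite in_itv in xab.
by rewrite -subr_ge0 h mulr_ge0 ?subr_ge0 ?(ltW ab)// df0//;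
  rewrite in_itv in cab.
Qed.

Lemma eq_of_derive0 f a b : a <= b ->
  (forall x, a < x < b -> is_derive x 1 f 0) ->
  {within `[a, b], continuous f} -> f a = f b.
Proof.
rewrite le_eqVlt => /predU1P[-> //|ab] dfx cf.
have [c cab h] : exists2 c, c \in `]a, b[%R & f b - f a = cst 0 c * (b - a).
  by apply: MVT => // x xab; apply: dfx; rewrite in_itv in xab.
by apply/eqP; rewrite eq_sym -subr_eq0 h mul0r.
Qed.

Lemma measurable_itvoo_cc f a b : measurable_fun `]a, b[ f ->
  measurable_fun `[a, b] f.
Proof.
move=> mf; apply/measurable_fun_itv_obnd_cbndP.
exact/measurable_fun_itv_bndo_bndcP.
Qed.

(** [f] may be unbounded near the endpoints. The theorem is applied on compact subintervals that
    exhaust the open interval; their integrals converge by monotone convergence, and the values of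
    [F] by its continuity up to the endpoints. *)
Lemma ge0_FTC_oo f F a b : a < b ->
  (forall x, a < x < b -> 0 <= f x) ->
  {within `[a, b], continuous F} ->
  (forall x, a < x < b -> is_derive x 1 F (f x)) ->
  (forall x, a < x < b -> {for x, continuous f}) ->
  measurable_fun `[a, b] f /\
  (\int[mu]_(x in `[a, b]) (f x)%:E = (F b - F a)%:E)%E.
Proof.
move=> ab f0 cF dF cf.
have mf : measurable_fun `]a, b[ f.
  apply: open_continuous_measurable_fun; first exact: interval_open.
  by move=> x; rewrite inE/= in_itv => /cf.
split; first exact: measurable_itvoo_cc.
rewrite integral_itv_bndoo; last exact/measurable_EFinP.
(* As [harmonic n <= 1], a margin of at most one third on each side keeps [an n < bn n] from [n = 0]
   on. *)
pose d := (b - a) / 3.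
have d0 : 0 < d by rewrite divr_gt0// subr_gt0.
pose an (n : nat) := a + d * harmonic n.
pose bn (n : nat) := b - d * harmonic n.
have h0 n : 0 < d * harmonic n by rewrite mulr_gt0// /harmonic/= invr_gt0.
have h1 n : d * harmonic n <= d.
  by rewrite ger_pMr// /harmonic/= invf_le1// ler1n.
have aan n : a < an n by rewrite /an ltrDl.
have bnb n : bn n < b by rewrite /bn ltrBlDr ltrDl.
have anbn n : an n < bn n.
  rewrite /an /bn; have := h1 n; have : b = a + 3 * d by rewrite /d; field.
  by move: d0 => + -> ; lra.
have E : `]a, b[%classic = \bigcup_n `[an n, bn n]%classic.
  apply/seteqP; split => x /=.
    rewrite in_itv/= => /andP[ax xb].
    pose m := Num.min (x - a) (b - x).
    have m0 : 0 < m by rewrite lt_min !subr_gt0 ax.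
    have [n hn] : exists n, d * harmonic n <= m.
      exists (Num.trunc (d / m)); rewrite /harmonic/= ler_pdivrMr//.
      rewrite mulrC -ler_pdivrMr//; apply: ltW.
      by apply: le_lt_trans (truncnS_gt _).
    exists n => //=; rewrite in_itv/= /an /bn.
    move: hn; rewrite /m le_min => /andP[? ?].
    by apply/andP; split; lra.
  move=> [n _] /=; rewrite !in_itv/= => /andP[h2 h3].
  by rewrite (lt_le_trans (aan n) h2) (le_lt_trans h3 (bnb n)).
have nd : nondecreasing_seq (fun n => `[an n, bn n]%classic).
  apply/nondecreasing_seqP => n; rewrite subsetEset; apply: subset_itvScc.
    rewrite bnd_simp /an lerD2l ler_pM2l// /harmonic/=
      lef_pV2 ?posrE// ler_nat//.
  rewrite bnd_simp /bn lerD2l lerN2 ler_pM2l// /harmonic/=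
    lef_pV2 ?posrE// ler_nat//.
have mfn n : measurable_fun `[an n, bn n] f.
  apply: measurable_funS mf => //.
  by rewrite E => x xn; exists n.
have c1 : (\int[mu]_(x in `[an n, bn n]) (f x)%:E)%E @[n --> \oo] -->
          (\int[mu]_(x in `]a, b[) (f x)%:E)%E.
  rewrite E; apply: ge0_nondecreasing_set_cvg_integral => //.
  - by move=> n; apply/measurable_EFinP; exact: mfn.
  - move=> n x xn; rewrite lee_fin f0//.
    have : `]a, b[%classic x by rewrite E; exists n.
    by rewrite /= in_itv.
have inab n x : an n <= x <= bn n -> a < x < b.
  move=> /andP[h2 h3].
  by rewrite (lt_le_trans (aan n) h2) (le_lt_trans h3 (bnb n)).
have each n : (\int[mu]_(x in `[an n, bn n]) (f x)%:E)%E =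
  (F (bn n) - F (an n))%:E.
  rewrite (@continuous_FTC2 _ f F)//.
  - apply: continuous_in_subspaceT => x; rewrite inE/= in_itv/= => /inab.
    exact: cf.
  - split.
    + move=> x; rewrite in_itv/= => /andP[h2 h3].
      have /inab/dF [] // : an n <= x <= bn n by rewrite (ltW h2) (ltW h3).
    + apply: cvg_at_right_filter; apply: is_derive_continuous.
      by apply: dF; apply: (inab n); rewrite lexx ltW.
    + apply: cvg_at_left_filter; apply: is_derive_continuous.
      by apply: dF; apply: (inab n); rewrite lexx ltW.
  - move=> x; rewrite in_itv/= => /andP[h2 h3].
    have /inab/dF [? <-] : an n <= x <= bn n by rewrite (ltW h2) (ltW h3).
    by rewrite derive1E.
have [_ cFa cFb] := (continuous_within_itvP _ ab).1 cF.
have ch : d * harmonic n @[n --> \oo] --> 0.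
  by rewrite -[X in _ --> X](mulr0 d); apply: cvgMr; exact: cvg_harmonic.
have c2 : (F (bn n) - F (an n))%:E @[n --> \oo] --> (F b - F a)%:E.
  apply: cvg_EFin; first by near=> n.
  apply: cvgB.
    move/cvg_at_leftP : cFb; apply; split; first exact: bnb.
    by rewrite -[X in _ --> X](subr0 b); apply: cvgB => //; exact: cvg_cst.
  move/cvg_at_rightP : cFa; apply; split; first exact: aan.
  by rewrite -[X in _ --> X](addr0 a); apply: cvgD => //; exact: cvg_cst.
have c3 : (\int[mu]_(x in `[an n, bn n]) (f x)%:E)%E @[n --> \oo] -->
  (F b - F a)%:E.
  by under eq_fun do rewrite each.
exact: (cvg_unique _ c1 c3).
Unshelve. all: by end_near. Qed.

Lemma integrable_ge0_finite f (A : set R) (r : R) : measurable A ->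
  measurable_fun A f -> (forall x, A x -> 0 <= f x) ->
  (\int[mu]_(x in A) (f x)%:E <= r%:E)%E -> mu.-integrable A (EFin \o f).
Proof.
move=> mA mf f0 fr; apply/integrableP; split; first exact/measurable_EFinP.
apply: (@le_lt_trans _ _ r%:E); last exact: ltry.
apply: le_trans fr; apply: ge0_le_integral => //.
- by apply: measurableT_comp => //; exact/measurable_EFinP.
- exact/measurable_EFinP.
- by move=> x Ax /=; rewrite lee_fin ger0_norm// f0.
Qed.

(** Induction on the exceptional points, cutting the interval at each one that lies inside it.
    Integrability is a conclusion here, since the sign of [f] makes a finite integral enough. *)
Lemma ge0_FTC (s : seq R) f F a b : a <= b ->
  (forall x, 0 <= f x) ->
  {within `[a, b], continuous F} ->
  (forall x, a < x < b -> x \notin s -> is_derive x 1 F (f x)) ->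
  (forall x, a < x < b -> x \notin s -> {for x, continuous f}) ->
  mu.-integrable `[a, b] (EFin \o f) /\
  (\int[mu]_(x in `[a, b]) (f x)%:E = (F b - F a)%:E)%E.
Proof.
move=> ab f0.
suff main : {within `[a, b], continuous F} ->
  (forall x, a < x < b -> x \notin s -> is_derive x 1 F (f x)) ->
  (forall x, a < x < b -> x \notin s -> {for x, continuous f}) ->
  measurable_fun `[a, b] f /\
  (\int[mu]_(x in `[a, b]) (f x)%:E = (F b - F a)%:E)%E.
  move=> cF dF cf; have [mf intf] := main cF dF cf; split => //.
  by apply: (@integrable_ge0_finite _ _ (F b - F a)) => //; rewrite intf.
elim: s a b ab => [|c s IH] a b ab cF dF cf.
  move: ab; rewrite le_eqVlt => /predU1P[<-|ab]; last first.
    apply: ge0_FTC_oo => //; [move=> x xab; exact: dF|move=> x xab; exact: cf].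
  rewrite set_itv1 integral_set1 subrr; split => //.
  exact: measurable_fun_set1.
have [/andP[ac cb]|ncab] := boolP (a < c < b); last first.
  by apply: IH => // x xab xs; [apply: dF|apply: cf] => //;
    rewrite inE negb_or xs andbT; apply: contraNneq ncab => <-.
have [mf1 i1] : measurable_fun `[a, c] f /\
    (\int[mu]_(x in `[a, c]) (f x)%:E = (F c - F a)%:E)%E.
  apply: IH; first exact: ltW.
  - by apply: continuous_subspaceW cF; apply: subset_itvScc => //; exact: ltW.
  - move=> x /andP[ax xc] xs; apply: dF; first by rewrite ax (lt_trans xc).
    by rewrite inE negb_or xs andbT lt_eqF.
  - move=> x /andP[ax xc] xs; apply: cf; first by rewrite ax (lt_trans xc).
    by rewrite inE negb_or xs andbT lt_eqF.
have [mf2 i2] : measurable_fun `[c, b] f /\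
    (\int[mu]_(x in `[c, b]) (f x)%:E = (F b - F c)%:E)%E.
  apply: IH; first exact: ltW.
  - by apply: continuous_subspaceW cF; apply: subset_itvScc => //; exact: ltW.
  - move=> x /andP[cx xb] xs; apply: dF; first by rewrite xb (lt_trans ac).
    by rewrite inE negb_or xs andbT gt_eqF.
  - move=> x /andP[cx xb] xs; apply: cf; first by rewrite xb (lt_trans ac).
    by rewrite inE negb_or xs andbT gt_eqF.
have E : `[a, b]%classic = `[a, c]%classic `|` `]c, b]%classic.
  by apply: itv_bndbnd_setU; rewrite bnd_simp ltW.
have mf2' : measurable_fun `]c, b] f.
  by apply: measurable_funS mf2 => //; exact: subset_itv_oc_cc.
have mf : measurable_fun (`[a, c] `|` `]c, b]) f.
  by apply/measurable_funU.
split; first by rewrite E.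
rewrite E ge0_integral_setU//=; last 3 first.
- exact/measurable_EFinP.
- by move=> x _; rewrite lee_fin.
- apply/disj_set2P; rewrite -subset0 => z/=; rewrite !in_itv/= => -[/andP[_]].
  by rewrite leNgt => /negbTE ->.
rewrite i1 integral_itv_obnd_cbnd; last exact/measurable_EFinP.
by rewrite i2 -EFinD; congr EFin; ring.
Qed.

(** Without a sign, monotone convergence is replaced by a comparison: [F] and the indefinite
    integral of [f] are both continuous on the closed interval and have the same derivative
    inside. *)
Lemma integrable_FTC_oo f F a b : a < b ->
  mu.-integrable `[a, b] (EFin \o f) ->
  {within `[a, b], continuous F} ->
  (forall x, a < x < b -> is_derive x 1 F (f x)) ->
  (forall x, a < x < b -> {for x, continuous f}) ->
  \int[mu]_(x in `[a, b]) f x = F b - F a.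
Proof.
move=> ab intf cF dF cf.
pose G x := parameterized_integral mu a x f.
have cG : {within `[a, b], continuous G}.
  by apply: parameterized_integral_continuous => //; exact: ltW.
have dG x : a < x < b -> is_derive x 1 G (f x).
  move=> /andP[ax xb].
  have [||d1 d2] := @continuous_FTC1 R f (BLeft a) x b xb intf.
  - exact: ax.
  - by apply: cf; rewrite ax.
  by apply: DeriveDef; [exact: d1|rewrite -derive1E; exact: d2].
have : (F - G) a = (F - G) b.
  apply: eq_of_derive0; first exact: ltW.
    move=> x xab; rewrite -(subrr (f x)).
    by apply: is_deriveB; [exact: dF|exact: dG].
  by move=> x; exact: (continuousB (cF x) (cG x)).
have -> : (F - G) a = F a.
  by rewrite !fctE /G /parameterized_integral set_itv1 Rintegral_set1 subr0.
by rewrite !fctE /G /parameterized_integral => h; lra.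
Qed.

Lemma integrable_FTC (s : seq R) f F a b : a <= b ->
  mu.-integrable `[a, b] (EFin \o f) ->
  {within `[a, b], continuous F} ->
  (forall x, a < x < b -> x \notin s -> is_derive x 1 F (f x)) ->
  (forall x, a < x < b -> x \notin s -> {for x, continuous f}) ->
  \int[mu]_(x in `[a, b]) f x = F b - F a.
Proof.
elim: s a b => [|c s IH] a b ab intf cF dF cf.
  move: ab intf cF dF cf; rewrite le_eqVlt => /predU1P[<-|ab] intf cF dF cf.
    by rewrite set_itv1 Rintegral_set1 subrr.
  by apply: integrable_FTC_oo => // x xab; [exact: dF|exact: cf].
have [/andP[ac cb]|ncab] := boolP (a < c < b); last first.
  by apply: IH => // x xab xs; [apply: dF|apply: cf] => //;
    rewrite inE negb_or xs andbT; apply: contraNneq ncab => <-.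
have acb : `[a, c] `<=` `[a, b] by apply: subset_itvScc => //; exact: ltW.
have cbb : `[c, b] `<=` `[a, b] by apply: subset_itvScc => //; exact: ltW.
have i1 : \int[mu]_(x in `[a, c]) f x = F c - F a.
  apply: IH; first exact: ltW.
  - exact: integrableS intf.
  - exact: continuous_subspaceW cF.
  - move=> x /andP[ax xc] xs; apply: dF; first by rewrite ax (lt_trans xc).
    by rewrite inE negb_or xs andbT lt_eqF.
  - move=> x /andP[ax xc] xs; apply: cf; first by rewrite ax (lt_trans xc).
    by rewrite inE negb_or xs andbT lt_eqF.
have i2 : \int[mu]_(x in `[c, b]) f x = F b - F c.
  apply: IH; first exact: ltW.
  - exact: integrableS intf.
  - exact: continuous_subspaceW cF.
  - move=> x /andP[cx xb] xs; apply: dF; first by rewrite xb (lt_trans ac).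
    by rewrite inE negb_or xs andbT gt_eqF.
  - move=> x /andP[cx xb] xs; apply: cf; first by rewrite xb (lt_trans ac).
    by rewrite inE negb_or xs andbT gt_eqF.
have := @Rintegral_itvB R f (BLeft a) (BRight b) c intf.
rewrite !bnd_simp => /(_ (ltW ac) (ltW cb)).
rewrite i1 Rintegral_itv_obnd_cbnd; last first.
  by apply: integrableS intf => //; apply: subset_trans cbb;
    exact: subset_itv_oc_cc.
by rewrite i2 => /eqP; rewrite subr_eq => /eqP ->; ring.
Qed.

Lemma cvg_integral_setT f : measurable_fun setT f -> (forall x, 0 <= f x) ->
  (\int[mu]_(x in `[(- n%:R)%R, (n%:R)%R]) (f x)%:E)%E @[n --> \oo] -->
  (\int[mu]_x (f x)%:E)%E.
Proof.
move=> mf f0.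
have -> : [set: R] = \bigcup_n `[- n%:R, n%:R]%classic.
  apply/seteqP; split => x //= _.
  exists (Num.trunc `|x|).+1 => //=; rewrite in_itv/= -ler_norml.
  exact/ltW/truncnS_gt.
apply: ge0_nondecreasing_set_cvg_integral => //.
- apply/nondecreasing_seqP => n; rewrite subsetEset; apply: subset_itvScc.
    by rewrite bnd_simp lerN2 ler_nat.
  by rewrite bnd_simp ler_nat.
- by move=> n; apply/measurable_EFinP; exact: measurable_funTS.
- by move=> n x _; rewrite lee_fin.
Qed.

(** The oriented integral from [0] to [x]: except at [x = 0], one of the two intervals is empty. *)
Definition primitive f x :=
  \int[mu]_(t in `[0, x]) f t - \int[mu]_(t in `[x, 0]) f t.

Lemma primitiveE f x : 0 <= x -> primitive f x = \int[mu]_(t in `[0, x]) f t.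
Proof.
rewrite /primitive le_eqVlt => /predU1P[<-|x0].
  by rewrite set_itv1 !Rintegral_set1 subrr.
by rewrite (_ : `[x, 0]%classic = set0) ?Rintegral_set0 ?subr0// set_itv_ge//
  bnd_simp -ltNge.
Qed.

Lemma is_derive_primitive f x : continuous f ->
  is_derive x 1 (primitive f) (f x).
Proof.
(* [- N] is a base point to the left of both [0] and [x], so that near [x] the oriented integral is
   a difference of two ordinary ones. *)
move=> cf; pose N := `|x| + 1.
have intf a b : mu.-integrable `[a, b] (EFin \o f).
  apply: continuous_compact_integrable; first exact: segment_compact.
  exact: continuous_subspaceT.
pose G y := \int[mu]_(t in `[- N, y]) f t.
have /andP[Nx xN] : - N < x < N by rewrite -ltr_norml /N ltrDl.
have dG : is_derive x 1 G (f x).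
  have [||d1 d2] := @continuous_FTC1 R f (BLeft (- N)) x N xN (intf _ _).
  - exact: Nx.
  - exact: cf.
  by apply: DeriveDef; [exact: d1|rewrite -derive1E; exact: d2].
have N0 : - N < 0 by rewrite oppr_lt0 /N ltr_wpDl.
apply: (@near_eq_is_derive _ _ _ (fun y => G y - G 0)); last first.
  by rewrite -[f x]subr0; apply: is_deriveB.
near=> y.
have Ny : - N < y by near: y; exact: lt_nbhsr.
have key a b : - N < a -> a <= b ->
    G b - G a = \int[mu]_(t in `[a, b]) f t.
  move=> Na ab; rewrite /G Rintegral_itvB ?bnd_simp//; last exact: ltW.
  by rewrite Rintegral_itv_obnd_cbnd//; apply: integrableS (intf a b) => //;
    exact: subset_itv_oc_cc.
have [y0|y0] := leP 0 y.
  by rewrite primitiveE// key.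
rewrite /primitive (_ : `[0, y]%classic = set0) ?Rintegral_set0 ?sub0r;
  last first.
  by rewrite set_itv_ge// bnd_simp -ltNge.
by rewrite -key// ?opprB// ltW.
Unshelve. all: by end_near. Qed.

Lemma primitive0 f : primitive f 0 = 0.
Proof. by rewrite primitiveE// set_itv1 Rintegral_set1. Qed.

Lemma eq_of_derive0_off f a : continuous f ->
  (forall x, x != a -> is_derive x 1 f 0) -> forall x, f x = f a.
Proof.
move=> cf df x; have [xa|ax] := leP x a.
- apply: eq_of_derive0 => //; last exact: continuous_subspaceT.
  by move=> y /andP[_ ya]; apply: df; rewrite lt_eqF.
- symmetry; apply: eq_of_derive0; first exact: ltW; last exact:
  continuous_subspaceT.
  by move=> y /andP[ay _]; apply: df; rewrite gt_eqF.
Qed.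

(** [f] minus a primitive of [g] is continuous with zero derivative off [a], hence constant. This
    serves at the top of the wave, where the square root in the formula for the slope cannot be
    differentiated. *)
Lemma is_derive_extend f g a : continuous f -> continuous g ->
  (forall x, x != a -> is_derive x 1 f (g x)) ->
  forall x, is_derive x 1 f (g x).
Proof.
move=> cf cg df x.
have cP : continuous (primitive g).
  by move=> y; apply: is_derive_continuous; exact: is_derive_primitive.
have E y : f y = primitive g y + (f a - primitive g a).
  have : (f - primitive g) y = (f - primitive g) a.
    apply: eq_of_derive0_off => [z|z za].
      by apply: continuousB; [exact: cf|exact: cP].
    rewrite -(subrr (g z)).
    by apply: is_deriveB; [exact: df|exact: is_derive_primitive].
  by rewrite !fctE => h; lra.
have -> : f = (fun y => primitive g y + (f a - primitive g a)) by apply/funext.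
by rewrite -[g x]addr0; apply: is_deriveD; exact: is_derive_primitive.
Qed.

Lemma homeo_inverse (X : R -> R) : continuous X ->
  {homo X : x y / x < y} -> (forall v, exists x, X x = v) ->
  exists T : R -> R, [/\ cancel X T, cancel T X & continuous T].
Proof.
move=> cX iX sX.
have mX : {mono X : x y / x <= y} by apply: le_mono.
pose T v := sval (cid (sX v)).
have TK : cancel T X by move=> v; rewrite /T; case: cid.
have XK : cancel X T by move=> x; apply: (inc_inj mX); rewrite TK.
exists T; split => // v.
rewrite -[v]TK.
by apply: (nbhs_singleton (near_can_continuous _ _));
  apply: filterE => x; [exact: XK|exact: cX].
Qed.

End calculus.

(** * Rules for derivatives and continuity at a point *)

Section pointwise_rules.
Context {R : realType}.
Implicit Types (f g : R -> R) (x a b : R).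

(* Unlike [is_derive], this is not a class: instance resolution would otherwise
   solve the premises of the rules, fixing the shape of the derivative. *)
Definition hderiv x f a := is_derive x 1 f a.
Lemma hderiv_cst x (c : R) : hderiv x (fun _ : R => c) 0.
Proof. exact: is_derive_cst. Qed.
Lemma hderiv_id x : hderiv x (fun t : R => t) 1.
Proof. exact: is_derive_id. Qed.
Lemma hderivD f g x a b : hderiv x f a -> hderiv x g b ->
  hderiv x (fun t => f t + g t) (a + b).
Proof. by move=> *; exact: is_deriveD. Qed.
Lemma hderivB f g x a b : hderiv x f a -> hderiv x g b ->
  hderiv x (fun t => f t - g t) (a - b).
Proof. by move=> *; exact: is_deriveB. Qed.
Lemma hderivN f x a : hderiv x f a -> hderiv x (fun t => - f t) (- a).
Proof. by move=> *; exact: is_deriveN. Qed.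
Lemma hderivM f g x a b : hderiv x f a -> hderiv x g b ->
  hderiv x (fun t => f t * g t) (a * g x + f x * b).
Proof.
move=> df dg; apply: (is_derive_eq (is_deriveM df dg)).
by rewrite /GRing.scale/= addrC mulrC.
Qed.
Lemma hderivV f x a : f x != 0 -> hderiv x f a ->
  hderiv x (fun t => (f t)^-1) (- a / f x ^+ 2).
Proof.
move=> f0 df; apply: (is_derive_eq (is_deriveV f0 df)).
by rewrite /GRing.scale/= mulNr mulrC -mulNr.
Qed.
Lemma hderiv_sqr f x a : hderiv x f a ->
  hderiv x (fun t => f t ^+ 2) (2 * f x * a).
Proof.
move=> df; apply: (is_derive_eq (is_deriveX 2 df)).
by rewrite /GRing.scale/= expr1.
Qed.
Lemma hderiv_comp f g x a b : hderiv (g x) f a -> hderiv x g b ->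
  hderiv x (fun t => f (g t)) (a * b).
Proof. by move=> *; exact: is_derive1_comp. Qed.
Lemma hderiv_expR g x b : hderiv x g b ->
  hderiv x (fun t => expR (g t)) (expR (g x) * b).
Proof. by move=> dg; apply: hderiv_comp dg; exact: is_derive_expR. Qed.
Lemma hderiv_ln g x b : 0 < g x -> hderiv x g b ->
  hderiv x (fun t => ln (g t)) (b / g x).
Proof.
by move=> g0 dg; rewrite mulrC; apply: hderiv_comp dg; exact: is_derive1_ln.
Qed.
Lemma hderiv_sqrt g x b : 0 < g x -> hderiv x g b ->
  hderiv x (fun t => Num.sqrt (g t)) (b / (2 * Num.sqrt (g x))).
Proof.
by move=> g0 dg; rewrite mulrC; apply: hderiv_comp dg; exact: is_derive1_sqrt.
Qed.

Lemma continuous_at_sqrt f x : {for x, continuous f} ->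
  {for x, continuous (fun t => Num.sqrt (f t))}.
Proof. by move=> cf; apply: continuous_comp => //; exact: sqrt_continuous. Qed.
Lemma continuous_atD f g x : {for x, continuous f} -> {for x, continuous g} ->
  {for x, continuous (fun t => f t + g t)}.
Proof. by move=> cf cg; exact: (continuousD cf cg). Qed.
Lemma continuous_atB f g x : {for x, continuous f} -> {for x, continuous g} ->
  {for x, continuous (fun t => f t - g t)}.
Proof. by move=> cf cg; exact: (continuousB cf cg). Qed.
Lemma continuous_atN f x : {for x, continuous f} ->
  {for x, continuous (fun t => - f t)}.
Proof. by move=> cf; exact: (continuousN cf). Qed.
Lemma continuous_atM f g x : {for x, continuous f} -> {for x, continuous g} ->
  {for x, continuous (fun t => f t * g t)}.
Proof. by move=> cf cg; exact: (continuousM cf cg). Qed.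
Lemma continuous_atV f x : f x != 0 -> {for x, continuous f} ->
  {for x, continuous (fun t => (f t)^-1)}.
Proof. by move=> f0 cf; exact: continuousV. Qed.
Lemma continuous_atX f n x : {for x, continuous f} ->
  {for x, continuous (fun t => f t ^+ n)}.
Proof.
by move=> cf; apply: (@continuous_comp _ _ _ f (fun y => y ^+ n)) => //;
  exact: exprn_continuous.
Qed.
Lemma continuous_at_ln f x : 0 < f x -> {for x, continuous f} ->
  {for x, continuous (fun t => ln (f t))}.
Proof. by move=> f0 cf; apply: continuous_comp => //; exact: continuous_ln. Qed.
Lemma continuous_at_comp f g x : {for x, continuous g} ->
  {for g x, continuous f} ->
  {for x, continuous (fun t => f (g t))}.
Proof. by move=> cf cg; exact: continuous_comp. Qed.
Lemma continuous_at_cst x (c : R) : {for x, continuous (fun _ : R => c)}.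
Proof. exact: cst_continuous. Qed.
Lemma continuous_at_id x : {for x, continuous (fun t : R => t)}.
Proof. exact: cvg_id. Qed.

Lemma is_derive_hderiv f x a b : hderiv x f a -> a = b -> is_derive x 1 f b.
Proof. by move=> h <-. Qed.

Lemma continuous_atP f : (forall x : R, {for x, continuous f}) -> continuous f.
Proof. by []. Qed.

End pointwise_rules.

Ltac derive_rules := repeat first [exact: hderiv_cst | exact: hderiv_id |
  eassumption | apply: hderiv_sqr |
  apply: hderivB | apply: hderivD | apply: hderivN | apply: hderivM |
  apply: hderiv_expR | apply: hderiv_ln | apply: hderiv_sqrt | apply: hderivV ].
Ltac continuous_rules := repeat
  match goal with
  | |- prop_for _ (inPhantom (forall y, continuous_at y ?f)) =>
    lazymatch f with
    | fun _ => ?c => exact: continuous_at_cst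
    | fun t => t => exact: continuous_at_id
    | fun t => @GRing.exp _ (@?g t) _ => apply: continuous_atX
    | fun t => @GRing.add _ (@?g t) (@GRing.opp _ (@?h t)) => apply:
      continuous_atB
    | fun t => @GRing.add _ (@?g t) (@?h t) => apply: continuous_atD
    | fun t => @GRing.opp _ (@?g t) => apply: continuous_atN
    | fun t => @GRing.mul _ (@?g t) (@?h t) => apply: continuous_atM
    | fun t => @GRing.inv _ (@?g t) => apply: continuous_atV
    | @GRing.inv _ => apply: (continuous_atV (fun t => t))
    | @ln _ => apply: (continuous_at_ln (fun t => t))
    | fun t => ln (@?g t) => apply: continuous_at_ln
    | fun t => Num.sqrt (@?g t) => apply: continuous_at_sqrt
    | _ => eassumption
    end
  end.

(** * The first integral and its parametrization *)

Section hyperbolic.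
Context {R : realType}.
Implicit Types (t u x y e z : R).

Definition cosh t : R := (expR t + expR (- t)) / 2.
Definition sinh t : R := (expR t - expR (- t)) / 2.

Lemma is_derive_cosh t : is_derive t 1 cosh (sinh t).
Proof.
by rewrite /cosh; apply: is_derive_hderiv; [derive_rules|rewrite /sinh; field].
Qed.
Lemma is_derive_sinh t : is_derive t 1 sinh (cosh t).
Proof.
by rewrite /sinh; apply: is_derive_hderiv; [derive_rules|rewrite /cosh; field].
Qed.

Lemma cosh_sinh t : cosh t ^+ 2 = 1 + sinh t ^+ 2.
Proof.
rewrite /cosh /sinh; have := expRxMexpNx_1 t.
move: (expR t) (expR (- t)) => a b h.
have -> : ((a + b) / 2) ^+ 2 = a * b + ((a - b) / 2) ^+ 2 by field.
by rewrite h.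
Qed.

Lemma cosh_gt0 t : 0 < cosh t.
Proof. by rewrite /cosh divr_gt0// addr_gt0// expR_gt0. Qed.
Lemma cosh_neq0 t : cosh t != 0. Proof. by rewrite gt_eqF// cosh_gt0. Qed.
Lemma cosh_ge1 t : 1 <= cosh t.
Proof.
have := cosh_sinh t; have := sqr_ge0 (sinh t); have := cosh_gt0 t.
by move: (cosh t) (sinh t ^+ 2) => c s; nra.
Qed.
Lemma coshN t : cosh (- t) = cosh t.
Proof. by rewrite /cosh opprK addrC. Qed.
Lemma sinhN t : sinh (- t) = - sinh t.
Proof. by rewrite /sinh opprK; field. Qed.
Lemma cosh0 : cosh 0 = 1. Proof. by rewrite /cosh oppr0 expR0; field. Qed.
Lemma sinh0 : sinh 0 = 0. Proof. by rewrite /sinh oppr0 subrr mul0r. Qed.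
Lemma sinh_gt0 t : 0 < t -> 0 < sinh t.
Proof. by move=> t0; rewrite /sinh divr_gt0// subr_gt0 ltr_expR; lra. Qed.
Lemma sinh_ge0 t : 0 <= t -> 0 <= sinh t.
Proof. by move=> t0; rewrite /sinh divr_ge0// subr_ge0 ler_expR; lra. Qed.
Lemma cosh_norm t : cosh `|t| = cosh t.
Proof.
by have [t0|t0] := leP 0 t; rewrite ?(ger0_norm t0) ?(ltr0_norm t0) ?coshN.
Qed.
Lemma continuous_cosh : continuous cosh.
Proof. by move=> t; exact: is_derive_continuous (is_derive_cosh t). Qed.
Lemma continuous_sinh : continuous sinh.
Proof. by move=> t; exact: is_derive_continuous (is_derive_sinh t). Qed.

Lemma cosh_le a b : 0 <= a -> a <= b -> cosh a <= cosh b.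
Proof.
move=> a0 ab; apply: (@le_of_derive_ge0 _ _ sinh) => //.
- by move=> x _; exact: is_derive_cosh.
- by move=> x /andP[ax _]; apply: sinh_ge0; rewrite (le_trans a0)// ltW.
- exact/continuous_subspaceT/continuous_cosh.
Qed.

Lemma cosh_ge_half_exp t : expR t / 2 <= cosh t.
Proof. by rewrite /cosh ler_pM2r// lerDl expR_ge0. Qed.

Lemma sqrt2_sqr : Num.sqrt 2 ^+ 2 = 2 :> R. Proof. by rewrite sqr_sqrtr. Qed.
Lemma sqrt2_gt0 : 0 < Num.sqrt 2 :> R. Proof. by rewrite sqrtr_gt0. Qed.
Lemma sqrt2_gt1 : 1 < Num.sqrt 2 :> R.
Proof. by rewrite -[ltLHS]sqrtr1 ltr_sqrt// ltr1n. Qed.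
Lemma sqrt2_lt2 : Num.sqrt 2 < 2 :> R.
Proof. by have := sqrt2_sqr; have := sqrt2_gt1; nra. Qed.

Definition sech_prof t : R := Num.sqrt 2 / cosh t.
Definition dsech_prof t : R := - (Num.sqrt 2 * sinh t) / cosh t ^+ 2.

Lemma is_derive_sech_prof t : is_derive t 1 sech_prof (dsech_prof t).
Proof.
have dc := is_derive_cosh t; have c0 := cosh_neq0 t.
by rewrite /sech_prof; apply: is_derive_hderiv;
  [derive_rules|rewrite /dsech_prof; field].
Qed.
Lemma continuous_sech_prof : continuous sech_prof.
Proof. by move=> t; exact: is_derive_continuous (is_derive_sech_prof t). Qed.
Lemma sech_prof_gt0 t : 0 < sech_prof t.
Proof. by rewrite divr_gt0 ?sqrt2_gt0 ?cosh_gt0. Qed.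
Lemma sech_prof_le t : sech_prof t <= Num.sqrt 2.
Proof.
by rewrite /sech_prof ler_pdivrMr ?cosh_gt0// ler_peMr ?cosh_ge1// ltW//
  sqrt2_gt0.
Qed.
Lemma sech_prof_sqr t : sech_prof t ^+ 2 = 2 / cosh t ^+ 2.
Proof. by rewrite /sech_prof expr_div_n sqrt2_sqr. Qed.
Lemma sech_prof0 : sech_prof 0 = Num.sqrt 2.
Proof. by rewrite /sech_prof cosh0 divr1. Qed.
Lemma sech_profN t : sech_prof (- t) = sech_prof t.
Proof. by rewrite /sech_prof coshN. Qed.
Lemma sech_prof_norm t : sech_prof `|t| = sech_prof t.
Proof. by rewrite /sech_prof cosh_norm. Qed.
Lemma sech_prof_anti a b : 0 <= a -> a <= b -> sech_prof b <= sech_prof a.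
Proof.
move=> a0 ab; rewrite /sech_prof ler_pM2l ?sqrt2_gt0// lef_pV2 ?posrE
  ?cosh_gt0//.
exact: cosh_le.
Qed.

(** It plays two roles, which is why this profile is chosen: it is twice the squared speed of
    [sech_prof], and [1 - quartic t / (1 + e ^+ 2)] is the argument of the logarithm in the
    energy. *)
Definition quartic t : R := sech_prof t ^+ 2 * (2 - sech_prof t ^+ 2).
Lemma quartic_dsech_prof t : quartic t = 2 * dsech_prof t ^+ 2.
Proof.
rewrite /quartic sech_prof_sqr /dsech_prof.
have -> : (- (Num.sqrt 2 * sinh t) / cosh t ^+ 2) ^+ 2 =
  Num.sqrt 2 ^+ 2 * sinh t ^+ 2 / (cosh t ^+ 2) ^+ 2 by field; exact: cosh_neq0.
rewrite sqrt2_sqr.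
have -> : sinh t ^+ 2 = cosh t ^+ 2 - 1 by rewrite cosh_sinh; ring.
by field; exact: cosh_neq0.
Qed.
Lemma quartic_ge0 t : 0 <= quartic t.
Proof. by rewrite quartic_dsech_prof mulr_ge0// sqr_ge0. Qed.
Lemma quarticE t : quartic t = 1 - (1 - sech_prof t ^+ 2) ^+ 2.
Proof. by rewrite /quartic; ring. Qed.
Lemma quarticN t : quartic (- t) = quartic t.
Proof. by rewrite /quartic sech_profN. Qed.
Lemma continuous_quartic : continuous quartic.
Proof.
apply: continuous_atP => t; have ct : {for t, continuous sech_prof} :=
  @continuous_sech_prof t.
by rewrite /quartic; continuous_rules.
Qed.

(* The value of [u' ^+ 2].  At [e = 0] this is [- ln `|1 - u ^+ 2|], hence [0] at
   [u = 1] by the convention [ln 0 = 0]. *)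
Definition energy e u : R := - ln (((1 - u ^+ 2) ^+ 2 + e ^+ 2) / (1 + e ^+ 2))
  / 2.

Lemma onePsqr_gt0 e : 0 < 1 + e ^+ 2.
Proof. by rewrite ltr_wpDr// sqr_ge0. Qed.
Lemma onePsqr_neq0 e : 1 + e ^+ 2 != 0.
Proof. by rewrite gt_eqF// onePsqr_gt0. Qed.

Lemma energy_ge0 e u : 0 <= u <= Num.sqrt 2 -> 0 <= energy e u.
Proof.
move=> /andP[u0 us]; rewrite /energy divr_ge0// oppr_ge0 ln_le0//.
rewrite ler_pdivrMr ?onePsqr_gt0// mul1r lerD2r.
have u2 : u ^+ 2 <= 2 by rewrite -sqrt2_sqr ler_pXn2r ?nnegrE ?(ltW sqrt2_gt0).
have : 0 <= u ^+ 2 by rewrite sqr_ge0.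
by move: (u ^+ 2) u2 => v v2 v0; nra.
Qed.

Lemma energy_gt0 e u : 0 < u < Num.sqrt 2 -> 0 < (1 - u ^+ 2) ^+ 2 + e ^+ 2 ->
  0 < energy e u.
Proof.
move=> /andP[u0 us] h; rewrite /energy divr_gt0// oppr_gt0 ln_lt0//.
rewrite divr_gt0 ?onePsqr_gt0//= ltr_pdivrMr ?onePsqr_gt0// mul1r ltrD2r.
have u2 : u ^+ 2 < 2 by rewrite -sqrt2_sqr ltr_pXn2r ?nnegrE ?(ltW sqrt2_gt0)//
  ltW.
have : 0 < u ^+ 2 by rewrite exprn_gt0.
by move: (u ^+ 2) u2 => v v2 v0; nra.
Qed.

Lemma energy_sech_prof e t :
  energy e (sech_prof t) = - ln (1 - quartic t / (1 + e ^+ 2)) / 2.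
Proof.
rewrite /energy quarticE; congr (- ln _ / 2); field; exact: onePsqr_neq0.
Qed.

(* Since [ln] is [0] on nonpositive numbers, this vanishes for [1 <= z], which is
   the continuous extension at [1]. *)
Definition log_ratio z : R := if z == 0 then 1 else z / (- ln (1 - z)).

(** For [0 < z < 1] this is [z <= - ln (1 - z) <= z / (1 - z)], where both inequalities are
    [ln (1 + w) <= w], with [w = - z] and [w = z / (1 - z)]. *)
Lemma log_ratio_bounds z : 0 <= z ->
  [/\ 1 - z <= log_ratio z, log_ratio z <= 1 & 0 <= log_ratio z].
Proof.
rewrite le_eqVlt => /predU1P[<-|z0]; first by rewrite /log_ratio eqxx subr0.
rewrite /log_ratio gt_eqF//.
have [z1|z1] := ltP z 1; last first.
  by rewrite ln0 ?oppr0 ?invr0 ?mulr0 ?subr_le0.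
have h1 : z <= - ln (1 - z).
  by rewrite lerNr (le_trans (le_ln1Dx _)) ?lexx// ltrNl opprK.
have l0 : 0 < - ln (1 - z) by exact: lt_le_trans h1.
have h2 : - ln (1 - z) <= z / (1 - z).
  rewrite -lnV ?posrE ?subr_gt0//.
  rewrite [X in ln X](_ : _ = 1 + z / (1 - z)); last by field;
    rewrite gt_eqF// subr_gt0.
  by apply: le_ln1Dx; apply: lt_le_trans (ltrN10 _) _;
    rewrite divr_ge0 ?subr_ge0// ltW.
split.
- by rewrite ler_pdivlMr// mulrC -ler_pdivlMr ?subr_gt0.
- by rewrite ler_pdivrMr// mul1r.
- by rewrite divr_ge0// ltW.
Qed.

Lemma log_ratio_neg_bounds z : z < 0 -> 1 <= log_ratio z <= 1 - z.
Proof.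
move=> z0; rewrite /log_ratio lt_eqF//.
have z1 : 0 < 1 - z by lra.
have h1 : ln (1 - z) <= - z by apply: le_ln1Dx; lra.
have h2 : - z / (1 - z) <= ln (1 - z).
  rewrite -[X in _ <= X]opprK -lnV ?posrE// lerNr -mulNr opprK.
  rewrite [X in ln X](_ : _ = 1 + z / (1 - z)); last by field; rewrite gt_eqF.
  by apply: le_ln1Dx; rewrite ltr_pdivlMr//; lra.
have l0 : 0 < ln (1 - z) by rewrite ln_gt0//; lra.
rewrite invrN mulrN -mulNr; apply/andP; split.
  by rewrite ler_pdivlMr// mul1r.
by rewrite ler_pdivrMr// mulrC -ler_pdivrMr.
Qed.

Lemma continuous_log_ratio : continuous log_ratio.
Proof.
move=> z; have [z1|z1|->] := ltgtP z 1.
- have [->|z0] := eqVneq z 0.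
    rewrite /continuous_at [X in _ --> X](_ : _ = 1);
      last by rewrite /log_ratio eqxx.
    apply/cvgrPdist_le => e e0; near=> y.
    have ye : `|y| <= e by near: y; exists e => // y /=;
      rewrite sub0r normrN => /ltW.
    have [y0|y0] := leP 0 y.
      have [h1 h2 _] := log_ratio_bounds y y0.
      by rewrite ger0_norm ?subr_ge0//; rewrite ger0_norm// in ye; lra.
    have /andP[h1 h2] := log_ratio_neg_bounds y y0.
    by rewrite ler0_norm ?subr_le0//; rewrite ltr0_norm// in ye; lra.
  have c : {for z, continuous (fun y : R => y / (- ln (1 - y)))}.
    continuous_rules; last by lra.
    rewrite oppr_eq0 ln_eq0; last by lra.
    by apply: contra_neq z0 => h; lra.
  rewrite /continuous_at {2}/log_ratio (negbTE z0); apply: cvg_trans c;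
    apply: near_eq_cvg.
  near=> y; rewrite /log_ratio ifF//; apply/negbTE.
  by near: y; exists `|z|; rewrite /= ?normr_gt0// => y;
    apply: contraTneq => ->; rewrite subr0 ltxx.
- rewrite /continuous_at [X in _ --> X](_ : _ = 0); last first.
    by rewrite /log_ratio gt_eqF ?ln0 ?oppr0 ?invr0 ?mulr0; lra.
  apply/cvgrPdist_le => e e0; near=> y; have y1 : 1 < y by near: y;
    exact: lt_nbhsr.
  by rewrite /log_ratio gt_eqF ?ln0 ?oppr0 ?invr0 ?mulr0 ?subrr ?normr0 ?ltW//;
    lra.
- rewrite /continuous_at [X in _ --> X](_ : _ = 0); last first.
    by rewrite /log_ratio oner_eq0 subrr ln0 ?oppr0 ?invr0 ?mulr0.
  apply/cvgrPdist_le => e e0; near=> y; rewrite sub0r normrN.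
  have y0 : 0 < y by near: y; apply: lt_nbhsr.
  have [_ _ m0] := log_ratio_bounds y (ltW y0); rewrite ger0_norm//.
  have [y1|y1] := leP 1 y.
    by rewrite /log_ratio gt_eqF// ln0 ?subr_le0// oppr0 invr0 mulr0 ltW.
  (* The neighbourhood of [1] is chosen so that [- ln (1 - y)] exceeds [e^-1]; as [y < 1], the ratio
     is then at most [e]. *)
  have ye : 1 - y < expR (- e^-1).
    by rewrite ltrBlDr -ltrBlDl; near: y; apply: lt_nbhsr;
      rewrite ltrBlDr ltrDl expR_gt0.
  have l1 : e^-1 <= - ln (1 - y).
    by rewrite lerNr ltW// -ltr_expR lnK// posrE subr_gt0.
  have l0 : 0 < - ln (1 - y) by apply: lt_le_trans l1; rewrite invr_gt0.
  rewrite /log_ratio gt_eqF// ler_pdivrMr//.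
  by apply: (le_trans (ltW y1)); rewrite -ler_pdivrMl// mulr1.
Unshelve. all: by end_near. Qed.

(* [dx / dt] when [u = sech_prof t], that is [`|dsech_prof t| / sqrt (energy e u)],
   in a form that stays continuous where the energy vanishes ([t = 0]) or blows
     up
   ([e = 0] and [u = 1]). *)
Definition stretch e t : R :=
  Num.sqrt ((1 + e ^+ 2) * log_ratio (quartic t / (1 + e ^+ 2))).

Lemma quartic_ratio_ge0 e t : 0 <= quartic t / (1 + e ^+ 2).
Proof. by rewrite divr_ge0 ?quartic_ge0// ltW// onePsqr_gt0. Qed.
Lemma stretch_ge0 e t : 0 <= stretch e t. Proof. exact: sqrtr_ge0. Qed.
Lemma stretch_sqr e t : stretch e t ^+ 2 =
  (1 + e ^+ 2) * log_ratio (quartic t / (1 + e ^+ 2)).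
Proof.
rewrite sqr_sqrtr// mulr_ge0 ?(ltW (onePsqr_gt0 e))//.
by have [] := log_ratio_bounds _ (quartic_ratio_ge0 e t).
Qed.
Lemma stretchN e t : stretch e (- t) = stretch e t.
Proof. by rewrite /stretch quarticN. Qed.
Lemma continuous_stretch e : continuous (stretch e).
Proof.
apply: continuous_atP => t; rewrite /stretch;
  have cq : {for t, continuous quartic} := @continuous_quartic t.
continuous_rules; apply: (@continuous_at_comp _ log_ratio); last exact:
  continuous_log_ratio.
by continuous_rules; exact: onePsqr_neq0.
Qed.
Lemma stretch_le e t : stretch e t <= Num.sqrt (1 + e ^+ 2).
Proof.
rewrite /stretch ler_wsqrtr// ler_piMr ?(ltW (onePsqr_gt0 e))//.
by have [] := log_ratio_bounds _ (quartic_ratio_ge0 e t).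
Qed.
Lemma stretch_le2 e t : e ^+ 2 <= 1 -> stretch e t <= 2.
Proof.
move=> e1; apply: le_trans (stretch_le e t) _.
rewrite -[leRHS]ger0_norm// -sqrtr_sqr ler_wsqrtr//.
by rewrite (_ : 2 ^+ 2 = 4 :> R); [lra|ring].
Qed.
(** This is [1 - z <= log_ratio z] multiplied by [1 + e ^+ 2]. It locates the possible zeros of
    [stretch] (only [e = 0] and [u = 1]) and makes [xpos] grow at least linearly. *)
Lemma stretch_sqr_ge e t : (1 - sech_prof t ^+ 2) ^+ 2 + e ^+ 2 <=
  stretch e t ^+ 2.
Proof.
rewrite stretch_sqr; have [h _ _] := log_ratio_bounds _ (quartic_ratio_ge0 e t).
apply: (@le_trans _ _ ((1 + e ^+ 2) * (1 - quartic t / (1 + e ^+ 2)))).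
  by rewrite quarticE le_eqVlt; apply/orP; left; apply/eqP; field;
    exact: onePsqr_neq0.
by rewrite ler_pM2l ?onePsqr_gt0.
Qed.
Lemma stretch_ge e t : 1 - sech_prof t ^+ 2 <= stretch e t.
Proof.
apply: le_trans (ler_norm _) _.
rewrite -[leRHS]ger0_norm ?stretch_ge0// -ler_sqr ?nnegrE// !real_normK
  ?num_real//.
by apply: le_trans (stretch_sqr_ge e t); rewrite lerDl sqr_ge0.
Qed.
Lemma stretch_gt0 e t : 0 < (1 - sech_prof t ^+ 2) ^+ 2 + e ^+ 2 ->
  0 < stretch e t.
Proof.
move=> h; rewrite lt0r stretch_ge0 andbT -sqrf_eq0 gt_eqF//.
exact: lt_le_trans (stretch_sqr_ge e t).
Qed.
(** The definition of [stretch] with denominators cleared. Positivity excludes [e = 0], [u = 1],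
    where the energy has only its default value; when [quartic] vanishes both sides are [0]. *)
Lemma stretch_energy e t : 0 < stretch e t ->
  stretch e t ^+ 2 * (2 * energy e (sech_prof t)) = quartic t.
Proof.
move=> k0; rewrite stretch_sqr energy_sech_prof.
have [z0|z0] := eqVneq (quartic t / (1 + e ^+ 2)) 0.
  rewrite z0 subr0 ln1 oppr0 mul0r !mulr0.
  by move/eqP: z0; rewrite mulf_eq0 invr_eq0 (negbTE (onePsqr_neq0 e)) orbF =>
    /eqP.
have : log_ratio (quartic t / (1 + e ^+ 2)) != 0.
  apply/eqP => m0; move: k0; rewrite /stretch m0 mulr0 sqrtr0 ltxx//.
rewrite /log_ratio (negbTE z0) mulf_eq0 negb_or z0/= invr_eq0 oppr_eq0.
set L := ln _ => L0; field; rewrite L0 onePsqr_neq0//.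
Qed.
Lemma dsech_prof_stretch e t : 0 < stretch e t ->
  (dsech_prof t / stretch e t) ^+ 2 = energy e (sech_prof t).
Proof.
move=> k0; have := stretch_energy e t k0; rewrite quartic_dsech_prof => h.
rewrite expr_div_n; apply: (@mulfI _ (2 * stretch e t ^+ 2)).
  by rewrite mulf_neq0// expf_neq0// gt_eqF.
rewrite mulrCA (mulrC (2 * _)) mulrA.
transitivity (2 * dsech_prof t ^+ 2); first by field; rewrite gt_eqF.
by rewrite -h; ring.
Qed.

End hyperbolic.

(** * The abscissa as a function of the parameter, its inverse, and the wave *)

Section travel_time.
Context {R : realType}.
Implicit Types (t u x y e z : R).
Notation mu := (@lebesgue_measure R).

Definition xpos e : R -> R := primitive (stretch e).

Lemma is_derive_xpos e t : is_derive t 1 (xpos e) (stretch e t).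
Proof. by apply: is_derive_primitive; exact: continuous_stretch. Qed.
Lemma continuous_xpos e : continuous (xpos e).
Proof. by move=> t; exact: is_derive_continuous (is_derive_xpos e t). Qed.
Lemma xpos0 e : xpos e 0 = 0. Proof. exact: primitive0. Qed.
Lemma xposN e t : xpos e (- t) = - xpos e t.
Proof.
pose f (s : R) : R := xpos e s + xpos e (- s).
have df (s : R) : is_derive s 1 f 0.
  have h1 := is_derive_xpos e s; have h2 := is_derive_xpos e (- s).
  rewrite /f; apply: is_derive_hderiv; first by apply: hderivD;
    [exact: h1|apply: hderiv_comp; [exact: h2|derive_rules]].
  by rewrite stretchN mulrN1 subrr.
have := @is_derive_0_is_cst _ f t 0 df.
by rewrite /f oppr0 xpos0 addr0 => /eqP; rewrite addrC addr_eq0 => /eqP.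
Qed.

Lemma xpos_mono e a b : a <= b -> xpos e a <= xpos e b.
Proof.
move=> ab; apply: (@le_of_derive_ge0 _ _ (stretch e)) => //.
- by move=> x _; exact: is_derive_xpos.
- by move=> x _; exact: stretch_ge0.
- exact/continuous_subspaceT/continuous_xpos.
Qed.

(* If [xpos e] were constant on an interval, [stretch e] would vanish there, so
   [sech_prof] would be constantly [1], although its derivative does not vanish
   at such points. *)
Lemma xpos_lt e : {homo xpos e : a b / a < b}.
Proof.
move=> a b ab; rewrite lt_neqAle xpos_mono ?ltW// andbT; apply/eqP => E.
pose p := (a + b) / 2.
have [ap pb] : a < p /\ p < b by rewrite /p; split; lra.
have Xc y : a <= y <= b -> xpos e y = xpos e a.
  move=> /andP[ay yb]; apply/eqP; rewrite eq_le (xpos_mono _ _ _ ay) andbT.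
  by rewrite E xpos_mono.
have k0 y : a < y < b -> stretch e y = 0.
  move=> /andP[ay yb]; have [_ <-] := is_derive_xpos e y.
  have h : is_derive y 1 (xpos e) 0.
    apply: (near_eq_is_derive _ (is_derive_cst (xpos e a) y (1 : R))).
    near=> z; rewrite Xc//.
    have az : a < z by near: z; exact: lt_nbhsr.
    have zb : z < b by near: z; exact: lt_nbhsl.
    by rewrite !ltW.
  exact: derive_val.
have p1 y : a < y < b -> sech_prof y = 1.
  move=> yab; have := stretch_sqr_ge e y; rewrite (k0 y yab) expr0n/= => h.
  have : (1 - sech_prof y ^+ 2) ^+ 2 == 0.
    by rewrite eq_le sqr_ge0 andbT (le_trans _ h)// lerDl sqr_ge0.
  rewrite sqrf_eq0 subr_eq0 eq_sym sqrf_eq1 => /orP[/eqP//|/eqP h1].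
  by have := sech_prof_gt0 y; rewrite h1; lra.
have d0 : dsech_prof p = 0.
  have [_ <-] := is_derive_sech_prof p.
  have h : is_derive p 1 (@sech_prof R) 0.
    apply: (near_eq_is_derive _ (is_derive_cst (1 : R) p (1 : R))).
    near=> z; rewrite p1//.
    have az : a < z by near: z; exact: lt_nbhsr.
    have zb : z < b by near: z; exact: lt_nbhsl.
    by rewrite az.
  exact: derive_val.
have : quartic p = 0 by rewrite quartic_dsech_prof d0 expr0n mulr0.
rewrite quarticE p1 ?ap//; lra.
Unshelve. all: by end_near. Qed.

Definition tanh t : R := sinh t / cosh t.
Lemma is_derive_tanh t : is_derive t 1 tanh (cosh t ^- 2).
Proof.
have h1 := is_derive_sinh t; have h2 := is_derive_cosh t.
have c0 := cosh_neq0 t.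
rewrite /tanh; apply: is_derive_hderiv; first by derive_rules.
have := cosh_sinh t; move: (cosh t) (sinh t) c0 => c s c0 h.
rewrite (_ : _ + _ = (c ^+ 2 - s ^+ 2) / c ^+ 2); last by field.
by rewrite h addrK div1r.
Qed.
Lemma tanh_le1 t : tanh t <= 1.
Proof.
rewrite /tanh ler_pdivrMr ?cosh_gt0// mul1r /sinh /cosh ler_pM2r//.
by have := expR_gt0 (- t); lra.
Qed.
Lemma tanh0 : tanh 0 = 0. Proof. by rewrite /tanh sinh0 mul0r. Qed.

(* [t - 2 * tanh t] is a primitive of [1 - sech_prof t ^+ 2]. *)
Lemma xpos_ge e t : 0 <= t -> t - 2 <= xpos e t.
Proof.
move=> t0; pose f (s : R) : R := xpos e s - (s - 2 * tanh s).
have h : f 0 <= f t.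
  apply: (@le_of_derive_ge0 _ _ (fun s => stretch e s - (1 - sech_prof s ^+ 2)))
    => //.
  - move=> s _; have h1 := is_derive_xpos e s; have h2 := is_derive_tanh s.
    by rewrite /f; apply: is_derive_hderiv; [derive_rules|rewrite sech_prof_sqr;
      ring].
  - by move=> s _; rewrite subr_ge0 stretch_ge.
  - apply: continuous_subspaceT; apply: continuous_atP => s.
    have h1 := is_derive_continuous _ _ _ (is_derive_xpos e s).
    have h2 := is_derive_continuous _ _ _ (is_derive_tanh s).
    by rewrite /f; continuous_rules.
move: h; rewrite /f xpos0 tanh0; have := tanh_le1 t; lra.
Qed.

Lemma xpos_le e t : 0 <= t -> xpos e t <= Num.sqrt (1 + e ^+ 2) * t.
Proof.
move=> t0; pose f (s : R) : R := Num.sqrt (1 + e ^+ 2) * s - xpos e s.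
have h : f 0 <= f t.
  apply: (@le_of_derive_ge0 _ _ (fun s => Num.sqrt (1 + e ^+ 2) - stretch e s))
    => //.
  - move=> s _; have h1 := is_derive_xpos e s.
    rewrite /f; apply: is_derive_hderiv.
      by apply: (hderivB _ _ _ _ _ _ h1);
        apply: (hderivM _ _ _ _ _ (hderiv_cst _ _) (hderiv_id _)).
    by rewrite mul0r mulr1 add0r.
  - by move=> s _; rewrite subr_ge0 stretch_le.
  - apply: continuous_subspaceT; apply: continuous_atP => s.
    have h1 := is_derive_continuous _ _ _ (is_derive_xpos e s).
    apply: (continuous_atB _ _ _ _ h1).
    by apply: continuous_atM;
      [exact: continuous_at_cst|exact: continuous_at_id].
by move: h; rewrite /f xpos0 mulr0 subrr subr_ge0.
Qed.

Lemma xpos_surj e v : exists t, xpos e t = v.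
Proof.
pose N := `|v| + 2.
have N0 : 0 <= N by rewrite /N addr_ge0.
have h : `|v| <= xpos e N by have := xpos_ge e N N0; rewrite /N; lra.
have [c _ <-] : exists2 c, c \in `[- N, N] & xpos e c = v.
  apply: IVT; first by lra.
    exact/continuous_subspaceT/continuous_xpos.
  rewrite xposN; apply/andP; split.
    rewrite ge_min; apply/orP; left.
    by apply: le_trans (_ : - `|v| <= _);
      rewrite ?lerN2// lerNl -normrN ler_norm.
  by rewrite le_max; apply/orP; right; apply: le_trans h; exact: ler_norm.
by exists c.
Qed.

Definition param e : R -> R :=
  sval (cid (homeo_inverse (xpos e) (continuous_xpos e) (@xpos_lt e)
    (xpos_surj e))).

Lemma paramP e : [/\ cancel (xpos e) (param e), cancel (param e) (xpos e) &
  continuous (param e)].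
Proof. by rewrite /param; case: cid. Qed.
Lemma xposK e : cancel (xpos e) (param e). Proof. by case: (paramP e). Qed.
Lemma paramK e : cancel (param e) (xpos e). Proof. by case: (paramP e). Qed.
Lemma continuous_param e : continuous (param e).
Proof. by case: (paramP e). Qed.
Lemma ltr_xpos e : {mono xpos e : a b / a < b}.
Proof. exact/leW_mono/le_mono/xpos_lt. Qed.
Lemma ler_xpos e : {mono xpos e : a b / a <= b}.
Proof. exact/le_mono/xpos_lt. Qed.
Lemma param0 e : param e 0 = 0. Proof. by rewrite -(xpos0 e) xposK xpos0. Qed.
Lemma paramN e x : param e (- x) = - param e x.
Proof. by rewrite -{1}(paramK e x) -xposN xposK. Qed.
Lemma param_gt0 e x : (0 < param e x) = (0 < x).
Proof. by rewrite -(ltr_xpos e) xpos0 paramK. Qed.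
Lemma param_ge0 e x : (0 <= param e x) = (0 <= x).
Proof. by rewrite -(ler_xpos e) xpos0 paramK. Qed.
Lemma param_norm e x : param e `|x| = `|param e x|.
Proof.
have [x0|x0] := leP 0 x; first by rewrite !ger0_norm ?param_ge0.
by rewrite !ltr0_norm ?paramN// ltNge param_ge0 -ltNge.
Qed.
Lemma param_ge e x : 0 <= x -> x / Num.sqrt (1 + e ^+ 2) <= param e x.
Proof.
move=> x0; rewrite ler_pdivrMr ?sqrtr_gt0 ?onePsqr_gt0//.
rewrite -{1}(paramK e x) mulrC; apply: xpos_le; by rewrite param_ge0.
Qed.
Lemma is_derive_param e x : 0 < stretch e (param e x) ->
  is_derive x 1 (param e) (stretch e (param e x))^-1.
Proof.
move=> k0; rewrite -{1}(paramK e x); apply: (@is_derive_inverse _ (xpos e)).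
- by apply: filterE => y; exact: xposK.
- by apply: filterE => y; exact: continuous_xpos.
- exact: is_derive_xpos.
- by rewrite gt_eqF.
Qed.

Definition usol e x : R := sech_prof (param e x).
(* The derivative of [usol e], except where [e = 0] and [usol e x = 1]: the slope
   is infinite there, and [dsol e x = 0]. *)
Definition dsol e x : R := - Num.sg x * Num.sqrt (energy e (usol e x)).

Lemma usol_gt0 e x : 0 < usol e x. Proof. exact: sech_prof_gt0. Qed.
Lemma usol_le e x : usol e x <= Num.sqrt 2. Proof. exact: sech_prof_le. Qed.
Lemma usol0 e : usol e 0 = Num.sqrt 2.
Proof. by rewrite /usol param0 sech_prof0. Qed.
Lemma usolN e x : usol e (- x) = usol e x.
Proof. by rewrite /usol paramN sech_profN. Qed.
Lemma usol_norm e x : usol e `|x| = usol e x.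
Proof. by rewrite /usol param_norm sech_prof_norm. Qed.
Lemma continuous_usol e : continuous (usol e).
Proof.
apply: continuous_atP => x; rewrite /usol; apply: continuous_at_comp;
  first exact: continuous_param.
exact: continuous_sech_prof.
Qed.
Lemma energy_usol_ge0 e x : 0 <= energy e (usol e x).
Proof. by apply: energy_ge0; rewrite usol_le ltW// usol_gt0. Qed.
Lemma energy_sqrt2 e : energy e (Num.sqrt 2) = 0.
Proof.
rewrite /energy sqrt2_sqr (_ : (1 - 2) ^+ 2 = 1 :> R); last by ring.
by rewrite divff ?onePsqr_neq0// ln1 oppr0 mul0r.
Qed.
Lemma dsol_sqr e x : dsol e x ^+ 2 = energy e (usol e x).
Proof.
rewrite /dsol exprMn sqrrN sqr_sqrtr ?energy_usol_ge0//.
have [->|x0] := eqVneq x 0; first by rewrite usol0 energy_sqrt2 mulr0.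
by rewrite sqr_sg x0 mul1r.
Qed.

(** The squares agree by [dsech_prof_stretch], and both sides have the sign opposite to that of [x].
    In the quotient form the continuity at [x = 0], where [Num.sg] jumps, becomes visible. *)
Lemma dsolE e x : 0 < stretch e (param e x) ->
  dsol e x = dsech_prof (param e x) / stretch e (param e x).
Proof.
move=> k0; rewrite /dsol /usol -dsech_prof_stretch// sqrtr_sqr normrM
  (gtr0_norm (x := _^-1)) ?invr_gt0//.
rewrite mulrA; congr (_ / _).
have [x0|x0|->] := ltgtP x 0.
- rewrite ltr0_sg// opprK mul1r ger0_norm// /dsech_prof divr_ge0 ?sqr_ge0//.
  rewrite oppr_ge0 mulr_ge0_le0 ?ltW ?sqrt2_gt0//.
  by rewrite -oppr_gt0 -sinhN sinh_gt0// oppr_gt0 ltNge param_ge0 -ltNge.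
- rewrite gtr0_sg// mulN1r ler0_norm ?opprK// /dsech_prof mulr_le0_ge0//.
    by rewrite oppr_le0 mulr_ge0 ?(ltW sqrt2_gt0)// ltW// sinh_gt0// param_gt0.
  by rewrite invr_ge0 sqr_ge0.
- by rewrite sgr0 oppr0 mul0r /dsech_prof param0 sinh0 mulr0 oppr0 mul0r.
Qed.

Lemma is_derive_usol e x : 0 < stretch e (param e x) ->
  is_derive x 1 (usol e) (dsol e x).
Proof.
move=> k0; rewrite dsolE//.
exact: (hderiv_comp _ _ _ _ _ (is_derive_sech_prof _) (is_derive_param _ _ k0)).
Qed.

Lemma continuous_dsech_prof : continuous (@dsech_prof R).
Proof.
apply: continuous_atP => t; have h1 : {for t, continuous cosh} :=
  @continuous_cosh R t.
have h2 : {for t, continuous sinh} := @continuous_sinh R t.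
by rewrite /dsech_prof; continuous_rules; rewrite expf_neq0// cosh_neq0.
Qed.

Lemma continuous_dsol e x : 0 < stretch e (param e x) ->
  {for x, continuous (dsol e)}.
Proof.
move=> k0.
have ct : {for x, continuous (param e)} := @continuous_param e x.
have c1 : {for x, continuous (fun y => stretch e (param e y))}.
  by apply: continuous_at_comp => //; exact: continuous_stretch.
have c2 : {for x, continuous (fun y => dsech_prof (param e y))}.
  by apply: continuous_at_comp => //; exact: continuous_dsech_prof.
have c : {for x, continuous (fun y => dsech_prof (param e y) / stretch e
  (param e y))}.
  by apply: (continuous_atM _ _ _ c2); apply: (continuous_atV _ _ _ c1);
    rewrite gt_eqF.
rewrite /prop_for /continuous_at (dsolE e x k0); apply: cvg_trans c.
apply: near_eq_cvg; near=> y; apply/esym/dsolE.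
by near: y; apply: (cvgr_gt (stretch e (param e x))).
Unshelve. all: by end_near. Qed.

Lemma sech_prof_le_inv t : 0 <= t -> sech_prof t <= 2 * Num.sqrt 2 / (1 + t).
Proof.
move=> t0; rewrite /sech_prof ler_pdivrMr ?cosh_gt0// mulrAC ler_pdivlMr;
  last by lra.
have h1 := cosh_ge_half_exp t; have h2 := expR_ge1Dx t.
by rewrite (mulrC 2) -mulrA ler_pM2l ?sqrt2_gt0//; lra.
Qed.

Lemma usol_cvgy e : usol e x @[x --> +oo] --> (0 : R).
Proof.
apply/cvgrPdist_le => d d0; near=> x.
have x0 : 0 <= x by near: x; exact: nbhs_pinfty_ge.
rewrite sub0r normrN gtr0_norm ?usol_gt0//.
pose c := Num.sqrt (1 + e ^+ 2).
have c0 : 0 < c by rewrite sqrtr_gt0 onePsqr_gt0.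
have t0 : 0 <= param e x by rewrite param_ge0.
apply: (le_trans (sech_prof_le_inv _ t0)); rewrite ler_pdivrMr; last by lra.
have h := param_ge e x x0.
have hx : c * (2 * Num.sqrt 2 / d) <= x by near: x; apply: nbhs_pinfty_ge;
  rewrite num_real.
have h2 : 2 * Num.sqrt 2 / d <= param e x.
  by apply: le_trans h; rewrite ler_pdivlMr// mulrC.
by move: h2; rewrite ler_pdivrMr// => h2; rewrite mulrDr; lra.
Unshelve. all: by end_near. Qed.

Lemma usol_cvgNy e : usol e x @[x --> -oo] --> (0 : R).
Proof.
apply/cvgNy_compNP; rewrite (_ : _ \o _ = usol e); first exact: usol_cvgy.
by apply/funext => x /=; rewrite usolN.
Qed.

(** The abscissa moves at speed at most [sqrt (1 + e ^+ 2) <= 2], so the parameter reached at [x] is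
    at least half of [x] in absolute value. This majorant, independent of [e], is the one used for
    dominated convergence in L^2. *)
Lemma usol_le_sech_prof e x : e ^+ 2 <= 1 -> usol e x <= sech_prof (x / 2).
Proof.
move=> e1; rewrite -usol_norm -(sech_prof_norm (x / 2)) normrM
  (ger0_norm (x := 2^-1))//.
apply: sech_prof_anti; first by rewrite divr_ge0.
apply: le_trans (param_ge e `|x| (normr_ge0 x)).
rewrite ler_wpM2l// lef_pV2 ?posrE ?sqrtr_gt0 ?onePsqr_gt0//.
rewrite -[leRHS]ger0_norm// -sqrtr_sqr ler_wsqrtr//.
by rewrite (_ : 2 ^+ 2 = 4 :> R); [lra|ring].
Qed.

End travel_time.

(** * Identification of the bell soliton *)

Section bell.
Context {R : realType}.
Implicit Types (t u x y e z : R).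
Notation mu := (@lebesgue_measure R).

(** This is [arcosh (sqrt 2 / u)], the nonnegative branch of the inverse of [sech_prof]. *)
Definition inv_sech_prof u : R := ln ((Num.sqrt 2 + Num.sqrt (2 - u ^+ 2)) / u).

Lemma inv_sech_prof_arg_gt0 u : 0 < u ->
  0 < (Num.sqrt 2 + Num.sqrt (2 - u ^+ 2)) / u.
Proof. by move=> u0; rewrite divr_gt0// ltr_pwDl ?sqrt2_gt0// sqrtr_ge0. Qed.

Lemma sqr_le2 u : 0 < u <= Num.sqrt 2 -> u ^+ 2 <= 2.
Proof.
by move=> /andP[u0 us]; rewrite -sqrt2_sqr ler_pXn2r ?nnegrE ?(ltW sqrt2_gt0)//
  ltW.
Qed.

Lemma inv_sech_profK u : 0 < u <= Num.sqrt 2 -> sech_prof (inv_sech_prof u) = u.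
Proof.
move=> us; have /andP[u0 _] := us; have u2 := sqr_le2 u us.
rewrite /sech_prof /cosh expRN /inv_sech_prof lnK ?posrE
  ?inv_sech_prof_arg_gt0//.
have s0 := @sqrt2_gt0 R; have s2 := @sqrt2_sqr R.
have r0 := sqrtr_ge0 (2 - u ^+ 2).
have r2 : Num.sqrt (2 - u ^+ 2) ^+ 2 =
  2 - u ^+ 2 by rewrite sqr_sqrtr// subr_ge0.
move: (Num.sqrt (2 - _)) r0 r2 => r r0 r2; move: (Num.sqrt 2) s0 s2 => s s0 s2.
have sr : s + r != 0 by rewrite gt_eqF// ltr_pwDl.
have un : u != 0 by rewrite gt_eqF.
have E : ((s + r) / u + ((s + r) / u)^-1) / 2 = s / u.
  rewrite (_ : _ / 2 = ((s + r) ^+ 2 + u ^+ 2) / (2 * u * (s + r))); last first.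
    by field; rewrite un sr.
  rewrite (_ : (s + r) ^+ 2 + u ^+ 2 = 2 * s * (s + r)); last first.
    have -> : u ^+ 2 = s ^+ 2 - r ^+ 2 by rewrite r2 s2; ring.
    by ring.
  by field; rewrite un sr.
by rewrite E invf_div mulrCA divff ?mulr1// gt_eqF.
Qed.

Lemma sech_profK t : 0 <= t -> inv_sech_prof (sech_prof t) = t.
Proof.
move=> t0; rewrite /inv_sech_prof.
have -> : Num.sqrt (2 - sech_prof t ^+ 2) = Num.sqrt 2 * (sinh t / cosh t).
  have -> : 2 - sech_prof t ^+ 2 = (Num.sqrt 2 * (sinh t / cosh t)) ^+ 2.
    have h : sinh t ^+ 2 = cosh t ^+ 2 - 1 by rewrite cosh_sinh; ring.
    rewrite sech_prof_sqr (_ : (_ * _) ^+ 2 =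
      Num.sqrt 2 ^+ 2 * sinh t ^+ 2 / cosh t ^+ 2).
      by rewrite sqrt2_sqr h; field; exact: cosh_neq0.
    by field; exact: cosh_neq0.
  rewrite sqrtr_sqr ger0_norm// mulr_ge0 ?(ltW sqrt2_gt0)//.
  by rewrite divr_ge0 ?sinh_ge0// ltW// cosh_gt0.
rewrite (_ : _ / _ = expR t) ?expRK//.
have : expR t = cosh t + sinh t by rewrite /cosh /sinh; field.
move=> ->; rewrite /sech_prof; field.
by rewrite cosh_neq0 gt_eqF// sqrt2_gt0.
Qed.

Lemma inv_sech_prof_ge0 u : 0 < u <= Num.sqrt 2 -> 0 <= inv_sech_prof u.
Proof.
move=> /andP[u0 us]; rewrite /inv_sech_prof ln_ge0// ler_pdivlMr// mul1r.
by apply: (le_trans us); rewrite lerDl sqrtr_ge0.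
Qed.

Lemma inv_sech_prof_sqrt2 : inv_sech_prof (Num.sqrt 2) = 0.
Proof. by rewrite -(@sech_prof0 R) sech_profK. Qed.

Lemma continuous_inv_sech_prof u : 0 < u -> {for u, continuous inv_sech_prof}.
Proof.
move=> u0; rewrite /inv_sech_prof; apply: continuous_at_ln; first exact:
  inv_sech_prof_arg_gt0.
by continuous_rules; rewrite gt_eqF.
Qed.

Lemma is_derive_inv_sech_prof u : 0 < u < Num.sqrt 2 ->
  is_derive u 1 inv_sech_prof (- Num.sqrt 2 / (u * Num.sqrt (2 - u ^+ 2))).
Proof.
move=> /andP[u0 us].
have u2 : 0 < 2 - u ^+ 2.
  by rewrite subr_gt0 -sqrt2_sqr ltr_pXn2r ?nnegrE ?(ltW sqrt2_gt0)// ltW.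
have a0 := inv_sech_prof_arg_gt0 u u0.
have un : u != 0 by rewrite gt_eqF.
have s0 := @sqrt2_gt0 R; have s2 := @sqrt2_sqr R.
have r0 : 0 < Num.sqrt (2 - u ^+ 2) by rewrite sqrtr_gt0.
have r2 : Num.sqrt (2 - u ^+ 2) ^+ 2 = 2 - u ^+ 2 by rewrite sqr_sqrtr// ltW.
have dr := hderiv_sqrt (fun y => 2 - y ^+ 2) u _ u2
  (hderivB _ _ _ _ _ (hderiv_cst _ 2) (hderiv_sqr _ _ _ (hderiv_id u))).
have dv := hderivV _ _ _ un (hderiv_id u).
rewrite /inv_sech_prof; apply: is_derive_hderiv.
  apply: hderiv_ln; first exact: a0.
  exact: (hderivM _ _ _ _ _ (hderivD _ _ _ _ _ (hderiv_cst _ (Num.sqrt 2)) dr)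
    dv).
rewrite /=; move: (Num.sqrt (2 - _)) r0 r2 => r r0 r2;
  move: (Num.sqrt 2) s0 s2 => s s0 s2.
have sr : s + r != 0 by rewrite gt_eqF// addr_gt0.
have rn : r != 0 by rewrite gt_eqF.
transitivity (- (u ^+ 2 + r * (s + r)) / (u * r * (s + r))).
  by field; rewrite rn un sr.
rewrite (_ : u ^+ 2 + r * (s + r) = s * (s + r)); last first.
  have -> : u ^+ 2 = s ^+ 2 - r ^+ 2 by rewrite r2 s2; ring.
  by ring.
by field; rewrite rn un sr.
Qed.

Lemma energy0_gt1 u : 1 <= u -> energy 0 u = - ln (u ^+ 2 - 1).
Proof.
move=> u1; rewrite /energy expr0n/= !addr0 divr1 (_ : (1 - u ^+ 2) ^+ 2 =
  (u ^+ 2 - 1) ^+ 2); last by ring.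
move: u1; rewrite le_eqVlt => /predU1P[<-|u1].
  by rewrite expr1n subrr expr0n/= ln0// oppr0 mul0r.
have h : 0 < u ^+ 2 - 1 by rewrite subr_gt0 exprn_egt1// .
rewrite lnXn// mulr2n; lra.
Qed.

Lemma energy0_lt1 u : 0 <= u <= 1 -> energy 0 u = - ln (1 - u ^+ 2).
Proof.
move=> /andP[u0 u1]; rewrite /energy expr0n/= !addr0 divr1.
move: u1; rewrite le_eqVlt => /predU1P[->|u1].
  by rewrite expr1n subrr expr0n/= ln0// oppr0 mul0r.
have h : 0 < 1 - u ^+ 2 by rewrite subr_gt0 exprn_ilt1.
rewrite lnXn// mulr2n; lra.
Qed.

Lemma stretch0_gt0 u : 0 < u <= Num.sqrt 2 -> u != 1 ->
  0 < stretch 0 (inv_sech_prof u).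
Proof.
move=> us u1; apply: stretch_gt0;
  rewrite inv_sech_profK// expr0n addr0 lt0r sqr_ge0 andbT.
rewrite sqrf_eq0 subr_eq0 eq_sym sqrf_eq1 (negbTE u1)/=.
by have /andP[u0 _] := us; apply: contraTneq u0 => ->; rewrite -leNgt lerN10.
Qed.

(** The change of variables [u = sech_prof t]. The integrand blows up at [sqrt 2], which [ge0_FTC]
    allows at an endpoint, and [1] is its exceptional point. *)
Lemma quadrature a b : 0 < a -> a <= b -> b <= Num.sqrt 2 ->
  mu.-integrable `[a, b] (EFin \o (fun u => (Num.sqrt (energy 0 u))^-1)) /\
  (\int[mu]_(u in `[a, b]) ((Num.sqrt (energy 0 u))^-1)%:E =
   (xpos 0 (inv_sech_prof a) - xpos 0 (inv_sech_prof b))%:E)%E.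
Proof.
move=> a0 ab bs.
have inab u : a < u < b -> 0 < u < Num.sqrt 2.
  by move=> /andP[au ub]; rewrite (lt_trans a0)//= (lt_le_trans ub).
have cF (x : R) : 0 < x ->
  {for x, continuous (fun u => - xpos 0 (inv_sech_prof u))}.
  move=> x0; apply: continuous_atN; apply: continuous_at_comp;
    last exact: continuous_xpos.
  exact: continuous_inv_sech_prof.
have [||||| h1 h2] := @ge0_FTC R [:: 1] (fun u => (Num.sqrt (energy 0 u))^-1)
  (fun u => - xpos 0 (inv_sech_prof u)) a b.
- exact: ab.
- by move=> x; rewrite invr_ge0 sqrtr_ge0.
- apply: continuous_in_subspaceT => x; rewrite inE/= in_itv/= => /andP[ax _].
  by apply: cF; exact: lt_le_trans ax.
- move=> u uab; rewrite inE => u1; have us := inab u uab; have /andP[u0 us'] :=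
  us.
  have us2 : 0 < u <= Num.sqrt 2 by rewrite u0 ltW.
  have k0 := stretch0_gt0 u us2 u1.
  apply: is_derive_hderiv.
    apply: hderivN; apply: (hderiv_comp (xpos 0));
      [exact: is_derive_xpos|exact: is_derive_inv_sech_prof].
  have := stretch_energy 0 (inv_sech_prof u) k0;
    rewrite /quartic inv_sech_profK//.
  have u2 : 0 < 2 - u ^+ 2.
    by rewrite subr_gt0 -sqrt2_sqr ltr_pXn2r ?nnegrE ?(ltW sqrt2_gt0)// ltW.
  have E0 : 0 < energy 0 u.
    apply: energy_gt0 => //; rewrite expr0n addr0 lt0r sqr_ge0 andbT.
    by have := stretch0_gt0 u us2 u1;
      rewrite sqrf_eq0 subr_eq0 eq_sym sqrf_eq1 (negbTE u1)/= => _;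
      apply: contraTneq u0 => ->; rewrite -leNgt lerN10.
  move: (stretch 0 (inv_sech_prof u)) k0 => k k0 h.
  (* The identity [stretch_energy] with square roots taken; all factors are nonnegative. *)
  have hs : k * Num.sqrt 2 * Num.sqrt (energy 0 u) =
      u * Num.sqrt (2 - u ^+ 2).
    apply/eqP; rewrite -(@eqrXn2 _ 2)// ?mulr_ge0 ?sqrtr_ge0 ?(ltW k0)
      ?(ltW u0)//.
    rewrite !exprMn sqrt2_sqr !sqr_sqrtr ?(ltW E0) ?(ltW u2)//.
    by rewrite -h mulrA.
  rewrite -hs; field.
  by rewrite !gt_eqF ?sqrtr_gt0.
- move=> u uab; rewrite inE => u1; have us := inab u uab; have /andP[u0 us'] :=
  us.
  have E0 : 0 < (1 - u ^+ 2) ^+ 2.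
    rewrite lt0r sqr_ge0 andbT sqrf_eq0 subr_eq0 eq_sym sqrf_eq1 (negbTE u1)/=.
    by apply: contraTneq u0 => ->; rewrite -leNgt lerN10.
  have E1 : 0 < energy 0 u by apply: energy_gt0 => //; rewrite expr0n addr0.
  apply: continuous_atV; first by rewrite gt_eqF// sqrtr_gt0.
  apply: continuous_at_sqrt; rewrite /energy; apply: continuous_atM;
    last exact: continuous_at_cst.
  apply: continuous_atN; apply: continuous_at_ln; last by continuous_rules.
  by rewrite expr0n/= !addr0 divr1.
by split => //; rewrite h2 opprK addrC.
Qed.

(* The positive abscissa at which [usol e] takes the value [1]. *)
Definition crest e : R := xpos e (inv_sech_prof 1).

Lemma one_le_sqrt2 : 0 < (1 : R) <= Num.sqrt 2.
Proof. by rewrite ltr01 ltW// sqrt2_gt1. Qed.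

Lemma crest0_gt0 : 0 < (crest 0).
Proof.
rewrite /crest -[ltLHS](xpos0 0) ltr_xpos lt_neqAle inv_sech_prof_ge0
  ?one_le_sqrt2// andbT.
apply/eqP => h; have := @sech_prof0 R; rewrite h inv_sech_profK ?one_le_sqrt2//.
by have := @sqrt2_gt1 R => + E; rewrite -E ltxx.
Qed.

Lemma bell_halfwidthE : bell_halfwidth R = (crest 0).
Proof.
rewrite /bell_halfwidth.
transitivity (\int[mu]_(u in `[1, Num.sqrt 2]) (Num.sqrt (energy 0 u))^-1).
  apply: eq_Rintegral => u; rewrite inE/= in_itv/= => /andP[u1 us].
  rewrite energy0_gt1// ler0_norm// ln_le0//.
  have := sqr_le2 u; rewrite us (lt_le_trans ltr01 u1) => /(_ isT); lra.
have [_ h] := quadrature 1 (Num.sqrt 2) ltr01 (ltW sqrt2_gt1) (lexx _).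
by rewrite /Rintegral h /= inv_sech_prof_sqrt2 xpos0 subr0.
Qed.

Lemma inv_sech_prof_usol x : inv_sech_prof (usol 0 x) = `|param 0 x|.
Proof. by rewrite /usol -sech_prof_norm sech_profK. Qed.

Lemma xpos_norm x : xpos 0 `|param 0 x| = `|x|.
Proof. by rewrite -param_norm paramK. Qed.

Lemma usol_eqP x u : 0 < u <= Num.sqrt 2 -> xpos 0 (inv_sech_prof u) = `|x| ->
  u = usol 0 x.
Proof.
by move=> us h; rewrite -(inv_sech_profK u us) -usol_norm -h /usol xposK.
Qed.

Lemma usol_ge1 x : `|x| <= (crest 0) -> 1 <= usol 0 x.
Proof.
move=> xh; rewrite -(inv_sech_profK 1 one_le_sqrt2) -usol_norm.
apply: sech_prof_anti; first by rewrite param_ge0.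
by rewrite -(ler_xpos 0) paramK.
Qed.

Lemma usol_lt1 x : (crest 0) < `|x| -> usol 0 x < 1.
Proof.
move=> xh; have us : 0 < usol 0 x <= Num.sqrt 2 by rewrite usol_gt0 usol_le.
rewrite ltNge; apply/negP => h.
have := sech_prof_anti (inv_sech_prof 1) (param 0 `|x|)
  (inv_sech_prof_ge0 1 one_le_sqrt2).
rewrite -(ler_xpos 0 (inv_sech_prof 1)) paramK (ltW xh) => /(_ isT).
rewrite inv_sech_profK ?one_le_sqrt2// -/(usol 0 _) usol_norm => h2.
have E : usol 0 x = 1 by apply/eqP; rewrite eq_le h2 h.
have := inv_sech_prof_usol x; rewrite E => h3.
by move: xh; rewrite /crest h3 xpos_norm ltxx.
Qed.

(** By [quadrature], the equation defining either profile reduces to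
    [xpos 0 (inv_sech_prof u) = |x|]: the half-width [crest 0] cancels on the head and is added back
    on the tail. [usol_eqP] shows that [usol 0 x] is its only solution, which evaluates [xget]. *)
Lemma bell_solitonE x : bell_soliton x = usol 0 x.
Proof.
have us : 0 < usol 0 x <= Num.sqrt 2 by rewrite usol_gt0 usol_le.
rewrite /bell_soliton bell_halfwidthE; case: ifPn => [xh|];
  last rewrite -ltNge => xh.
  have u1 := usol_ge1 x xh.
  have key u : 1 <= u <= Num.sqrt 2 ->
      (\int[mu]_(xi in `[1%R, u]) ((Num.sqrt (- ln (xi ^+ 2 - 1)))^-1)%:E =
       ((crest 0) - xpos 0 (inv_sech_prof u))%:E)%E.
    move=> /andP[h1 h2]; have [_ <-] := quadrature 1 u ltr01 h1 h2.
    apply: eq_integral => y; rewrite inE/= in_itv/= => /andP[y1 _].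
    by rewrite energy0_gt1.
  apply: xget_unique => /=.
    split; first by rewrite u1 usol_le.
    by rewrite bell_halfwidthE key ?u1 ?usol_le// inv_sech_prof_usol xpos_norm.
  move=> u [hu]; rewrite bell_halfwidthE key// => -[h].
  apply: usol_eqP; last by lra.
  by have /andP[? ->] := hu; rewrite (lt_le_trans ltr01).
have h0 := crest0_gt0.
rewrite /cusped_soliton gt_eqF ?subr_gt0//.
have u1 := usol_lt1 x xh.
have key u : 0 < u < 1 ->
    (\int[mu]_(xi in `[u, 1%R]) ((Num.sqrt (- ln (1 - xi ^+ 2)))^-1)%:E =
     (xpos 0 (inv_sech_prof u) - (crest 0))%:E)%E.
  move=> /andP[h1 h2]; have [_ <-] :=
    quadrature u 1 h1 (ltW h2) (ltW sqrt2_gt1).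
  apply: eq_integral => y; rewrite inE/= in_itv/= => /andP[uy y1].
  by rewrite energy0_lt1// y1 (le_trans (ltW h1)).
have n0 : `| `|x| - (crest 0) | = `|x|
  - (crest 0) by rewrite ger0_norm// subr_ge0 ltW.
apply: xget_unique => /=.
  split; first by rewrite u1 usol_gt0.
  by rewrite n0 key ?u1 ?usol_gt0// inv_sech_prof_usol xpos_norm.
move=> u [hu]; rewrite n0 key// => -[h].
apply: usol_eqP; last by lra.
by have /andP[-> ?] := hu; rewrite ltW// (lt_trans _ sqrt2_gt1).
Qed.

End bell.

(** * Existence and uniqueness *)

Section smoothness.
Context {R : realType}.
Implicit Types (f g : R -> R).

(** Each derivative is given by a witness, so closure under sums, products and inverses follows by
    induction without formulas for higher derivatives. *)
Fixpoint iter_derivable (n : nat) f : Prop :=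
  if n is m.+1 then exists g, (forall x : R, is_derive x 1 f (g x)) /\
    iter_derivable m g
  else True.

Lemma iter_derivableW n f : iter_derivable n.+1 f -> iter_derivable n f.
Proof.
elim: n f => [//|n IH] f [g [dg cg]]; exists g; split => //; exact: IH.
Qed.
Lemma iter_derivable_cst n (c : R) : iter_derivable n (fun _ => c).
Proof.
elim: n c => [//|n IH] c; exists (fun _ => 0); split => [x|];
  [exact: hderiv_cst|exact: IH].
Qed.
Lemma iter_derivableD n f g : iter_derivable n f -> iter_derivable n g ->
  iter_derivable n (fun x => f x + g x).
Proof.
elim: n f g => [//|n IH] f g [f' [df cf]] [g' [dg cg]].
exists (fun x => f' x + g' x); split => [x|]; last exact: IH.
exact: (hderivD _ _ _ _ _ (df x) (dg x)).
Qed.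
Lemma iter_derivableN n f : iter_derivable n f ->
  iter_derivable n (fun x => - f x).
Proof.
elim: n f => [//|n IH] f [f' [df cf]].
exists (fun x => - f' x); split => [x|]; last exact: IH.
exact: (hderivN _ _ _ (df x)).
Qed.
Lemma iter_derivableM n f g : iter_derivable n f -> iter_derivable n g ->
  iter_derivable n (fun x => f x * g x).
Proof.
elim: n f g => [//|n IH] f g hf hg.
have [f' [df cf]] := hf; have [g' [dg cg]] := hg.
exists (fun x => f' x * g x + f x * g' x); split => [x|].
  exact: (hderivM _ _ _ _ _ (df x) (dg x)).
by apply: iter_derivableD; apply: IH => //; exact: iter_derivableW.
Qed.
Lemma iter_derivableV n f : (forall x, f x != 0) -> iter_derivable n f ->
  iter_derivable n (fun x => (f x)^-1).
Proof.
move=> f0; elim: n => [//|n IH] hf; have [f' [df cf]] := hf.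
exists (fun x => - f' x * ((f x)^-1 * (f x)^-1)); split => [x|].
  apply: is_derive_hderiv; first exact: (hderivV _ _ _ (f0 x) (df x)).
  by rewrite expr2 invfM.
have h := IH (iter_derivableW _ _ hf).
by apply: iter_derivableM; [exact: iter_derivableN|exact: iter_derivableM].
Qed.

Lemma smooth_iter_derivable f : (forall n, iter_derivable n f) -> smooth f.
Proof.
move=> cf n x; have := cf n.+1; elim: n f {cf} x => [|n IH] f x [g [dg cg]].
  by have [] := dg x.
have fg : f^`()%classic = g by apply/funext => y; rewrite derive1E;
  have [_ <-] := dg y.
by rewrite derive1Sn fg; exact: IH.
Qed.

End smoothness.

(** * Smoothness of the profile and uniqueness for the Cauchy problem *)

Section ode.
Context {R : realType}.
Implicit Types (e x t u : R) (v : R -> R).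

Definition denom e u : R := (1 - u ^+ 2) ^+ 2 + e ^+ 2.
Definition force e u : R := u * (1 - u ^+ 2) / denom e u.

Lemma denom_gt0 e u : e != 0 -> 0 < denom e u.
Proof.
by move=> e0; rewrite /denom ltr_wpDl ?sqr_ge0// lt0r sqrf_eq0 e0 sqr_ge0.
Qed.

Lemma is_derive_energy e u : e != 0 -> is_derive u 1 (energy e) (2 * force e u).
Proof.
move=> e0; have d0 := denom_gt0 e u e0.
have dd : hderiv u (fun u => ((1 - u ^+ 2) ^+ 2 + e ^+ 2) / (1 + e ^+ 2))
    (- 4 * (u * (1 - u ^+ 2)) / (1 + e ^+ 2)).
  apply: is_derive_hderiv.
    apply: hderivM; last exact: hderiv_cst.
    apply: hderivD; last exact: hderiv_cst.
    apply: hderiv_sqr; apply: hderivB; [exact: hderiv_cst|apply: hderiv_sqr;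
      exact: hderiv_id].
  by rewrite /=; field; exact: onePsqr_neq0.
rewrite /energy; apply: is_derive_hderiv.
  apply: hderivM; last exact: hderiv_cst.
  by apply: hderivN; apply: hderiv_ln dd; rewrite divr_gt0// onePsqr_gt0.
rewrite /force -/(denom e u); field.
by rewrite gt_eqF// onePsqr_neq0.
Qed.

Lemma stretch_gt0_eps e t : e != 0 -> 0 < stretch e t.
Proof. by move=> e0; apply: stretch_gt0; exact: denom_gt0. Qed.

Lemma sech_prof_lt_sqrt2 t : t != 0 -> sech_prof t < Num.sqrt 2.
Proof.
move=> t0; rewrite -sech_prof_norm /sech_prof ltr_pdivrMr ?cosh_gt0// ltr_pMr
  ?sqrt2_gt0//.
have s0 : 0 < sinh `|t| by rewrite sinh_gt0// normr_gt0.
have := cosh_sinh `|t|; have := cosh_gt0 `|t|.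
by move: (cosh `|t|) (sinh `|t|) s0 => c s; nra.
Qed.

Lemma usol_lt_sqrt2 e x : x != 0 -> usol e x < Num.sqrt 2.
Proof.
move=> x0; apply: sech_prof_lt_sqrt2; apply: contra_neq x0 => h.
by rewrite -(paramK e x) h xpos0.
Qed.

Lemma continuous_force e : e != 0 -> continuous (force e).
Proof.
move=> e0; apply: continuous_atP => u; rewrite /force /denom;
  apply: continuous_atM; first by continuous_rules.
by apply: continuous_atV;
  [rewrite gt_eqF// -/(denom e u) denom_gt0|continuous_rules].
Qed.

(** Off [0] the sign is locally constant and the energy is positive, so the chain rule applies, and
    the factor [Num.sg x ^+ 2 = 1] leaves the force. At [0] the energy vanishes under the root, and
    [is_derive_extend] takes over. *)
Lemma is_derive_dsol e x : e != 0 ->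
  is_derive x 1 (dsol e) (force e (usol e x)).
Proof.
move=> e0; move: x; apply:
  (@is_derive_extend _ (dsol e) (fun x => force e (usol e x)) 0).
- by apply: continuous_atP => x; apply: continuous_dsol; exact: stretch_gt0_eps.
- apply: continuous_atP => x; apply: continuous_at_comp; first exact:
  continuous_usol.
  exact: continuous_force.
move=> x x0.
have E0 : 0 < energy e (usol e x).
  by apply: energy_gt0; [rewrite usol_gt0 usol_lt_sqrt2|exact: denom_gt0].
have du := is_derive_usol e x (stretch_gt0_eps e _ e0).
have ds := hderiv_sqrt (fun y => energy e (usol e y)) _ _ E0
  (hderiv_comp _ _ _ _ _ (is_derive_energy e _ e0) du).
have dn : is_derive x 1 (fun y => - Num.sg x * Num.sqrt (energy e (usol e y)))
    (force e (usol e x)).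
  apply: is_derive_hderiv; first by apply:
    (hderivM _ _ _ _ _ (hderiv_cst _ _) ds).
  rewrite mul0r add0r /dsol mulrA.
  have s0 : Num.sqrt (energy e (usol e x)) != 0 by rewrite gt_eqF// sqrtr_gt0.
  have s1 : Num.sg x ^+ 2 = 1 by rewrite sqr_sg x0.
  move: (Num.sqrt _) (Num.sg x) s0 s1 => s g s0 s1.
  transitivity (g ^+ 2 * force e (usol e x)); first by field.
  by rewrite s1 mul1r.
apply: near_eq_is_derive dn.
have [xn|xp|] := ltgtP x 0; last by move/eqP; rewrite (negbTE x0).
- near=> y; rewrite /dsol; congr (- _ * _); have yn : y < 0 by near: y;
  exact: lt_nbhsl.
  by rewrite (ltr0_sg xn) (ltr0_sg yn).
- near=> y; rewrite /dsol; congr (- _ * _); have yp : 0 < y by near: y;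
  exact: lt_nbhsr.
  by rewrite (gtr0_sg xp) (gtr0_sg yp).
Unshelve. all: by end_near. Qed.

Lemma usol_smooth e : e != 0 -> smooth (usol e).
Proof.
move=> e0; apply: smooth_iter_derivable.
(* A bootstrap on the pair: [usol] gains a derivative from [dsol], and [dsol] gains one because its
   derivative is a rational expression in [usol] with nonvanishing denominator. *)
suff h n : iter_derivable n (usol e) /\ iter_derivable n (dsol e) by move=> n;
  have [] := h n.
elim: n => [//|n [h1 h2]]; split.
  exists (dsol e); split => // x;
    exact: is_derive_usol (stretch_gt0_eps e _ e0).
exists (fun x => force e (usol e x)); split => [x|]; first exact:
  is_derive_dsol.
have hs : iter_derivable n (fun x => 1 - usol e x ^+ 2).
  by apply: iter_derivableD; [exact: iter_derivable_cst|apply: iter_derivableN;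
    exact: iter_derivableM].
apply: iter_derivableM; first exact: iter_derivableM.
apply: iter_derivableV => [x|]; first by rewrite gt_eqF// denom_gt0.
by apply: iter_derivableD; [exact: iter_derivableM|exact: iter_derivable_cst].
Qed.

Lemma usol_wave e : 0 < e -> solitary_wave e (usol e).
Proof.
move=> ep; have e0 : e != 0 by rewrite gt_eqF.
split; [exact: usol_smooth| |exact: usol_cvgy|exact: usol_cvgNy|].
  move=> x; have E : (usol e)^`()%classic = dsol e.
    apply/funext => y; rewrite derive1E.
    by have [_ ->] := is_derive_usol e y (stretch_gt0_eps e _ e0).
  rewrite derive1nS derive1n1 E derive1E.
  by have [_ ->] := is_derive_dsol e x e0.
by move=> x; rewrite usol_gt0 usol_le.
Qed.

Lemma force_lipschitz e : e != 0 -> exists2 L, 0 <= L &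
  forall a b, 0 < a <= Num.sqrt 2 -> 0 < b <= Num.sqrt 2 ->
    `|force e a - force e b| <= L * `|a - b|.
Proof.
(* The numerator of the difference quotient splits as [G1 + G2] below. The bounds are [7] for
   [1 - a^2 - ab - b^2], [1 + e^2] for [denom e b], [2] for [b * (1 - b^2)] and [4 * 2] for the last
   factor; each denominator is at least [e^2]. *)
move=> e0; exists ((7 * (1 + e ^+ 2) + 2 * 8) / (e ^+ 2 * e ^+ 2)).
  apply: divr_ge0; last by rewrite mulr_ge0 ?sqr_ge0.
  by rewrite addr_ge0// mulr_ge0// ltW// onePsqr_gt0.
have s2 := @sqrt2_lt2 R; have ss := @sqrt2_sqr R.
have bnd (a : R) : 0 < a <= Num.sqrt 2 -> [/\ 0 < a, a < 2 & a ^+ 2 <= 2].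
  move=> /andP[a0 as2]; split => //; first exact: le_lt_trans s2.
  by rewrite -ss ler_pXn2r ?nnegrE ?(ltW sqrt2_gt0)// ltW.
move=> a b /bnd[a0 a2 aa] /bnd[b0 b2 bb].
have da := denom_gt0 e a e0; have db := denom_gt0 e b e0.
pose G1 := (1 - a ^+ 2 - a * b - b ^+ 2) * denom e b.
pose G2 := b * (1 - b ^+ 2) * ((a + b) * (2 - a ^+ 2 - b ^+ 2)).
have -> : force e a - force e b = (G1 + G2) / (denom e a * denom e b) * (a - b).
  rewrite /force /G1 /G2; have := da; have := db; rewrite /denom => ? ?.
  by field; rewrite !gt_eqF.
rewrite normrM ler_wpM2r// normrM normfV.
have e2 : 0 < e ^+ 2 by rewrite lt0r sqrf_eq0 e0 sqr_ge0.
have de u : e ^+ 2 <= denom e u by rewrite /denom lerDr sqr_ge0.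
apply: ler_pM; rewrite ?invr_ge0//; last first.
  have ee : 0 < e ^+ 2 * e ^+ 2 by exact: mulr_gt0.
  have dd : 0 < denom e a * denom e b by exact: mulr_gt0.
  rewrite gtr0_norm// lef_pV2 ?posrE//.
  by apply: ler_pM => //; exact: ltW.
apply: (le_trans (ler_normD _ _)); apply: lerD; rewrite normrM.
  apply: ler_pM => //.
    by rewrite ler_norml; apply/andP; split; nra.
  rewrite gtr0_norm// /denom lerD2r.
  have : 0 <= b ^+ 2 by exact: sqr_ge0.
  by move: (b ^+ 2) bb => c ? ?; nra.
apply: ler_pM => //.
  rewrite normrM -[leRHS]mulr1; apply: ler_pM => //.
    by rewrite gtr0_norm// ltW.
  have : 0 <= b ^+ 2 by exact: sqr_ge0.
  by rewrite ler_norml; move: (b ^+ 2) bb => c ? ?; lra.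
rewrite normrM (_ : 8 = 4 * 2); last by ring.
apply: ler_pM => //; first by rewrite ger0_norm; lra.
have : 0 <= b ^+ 2 by exact: sqr_ge0.
have : 0 <= a ^+ 2 by exact: sqr_ge0.
by rewrite ler_norml; lra.
Qed.

(** [phi y * exp (- K * y)] is nonincreasing and starts at [0], while [phi] is nonnegative. The sign
    in [psi] turns this into a nondecreasing function, as [le_of_derive_ge0] requires. *)
Lemma gronwall0 (phi dphi : R -> R) (K : R) :
  (forall x, is_derive x 1 phi (dphi x)) -> (forall x, 0 <= phi x) ->
  (forall x, dphi x <= K * phi x) -> phi 0 = 0 ->
  forall x, 0 <= x -> phi x = 0.
Proof.
move=> dp p0 pK pz x x0.
pose psi (y : R) : R := - (phi y * expR (- K * y)).
have dpsi (y : R) : is_derive y 1 psi ((K * phi y - dphi y) * expR (- K * y)).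
  have h := dp y; rewrite /psi; apply: is_derive_hderiv.
    apply: hderivN; apply: (hderivM _ _ _ _ _ h); apply: hderiv_expR.
    by apply: (hderivM _ _ _ _ _ (hderiv_cst _ _) (hderiv_id _)).
  by rewrite /=; ring.
have : psi 0 <= psi x.
  apply: (le_of_derive_ge0 psi _ 0 x x0) => [y _|].
    by rewrite mulr_ge0 ?expR_ge0// subr_ge0.
  by apply: continuous_subspaceT; apply: continuous_atP => y;
    exact: is_derive_continuous (dpsi y).
rewrite /psi pz mul0r oppr0 oppr_ge0 pmulr_lle0 ?expR_gt0// => h.
by apply/eqP; rewrite eq_le h p0.
Qed.

(** Gronwall for the squared distance in the phase plane. With differences [p], [q] of values and
    slopes, the constant [1 + L] comes from [2pq <= p^2 + q^2] and
    [2|q| * L|p| <= L * (p^2 + q^2)]. *)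
Lemma ode_unique_right e (v1 v2 d1 d2 : R -> R) : e != 0 ->
  (forall x, is_derive x 1 v1 (d1 x)) -> (forall x, is_derive x 1 v2 (d2 x)) ->
  (forall x, is_derive x 1 d1 (force e (v1 x))) ->
  (forall x, is_derive x 1 d2 (force e (v2 x))) ->
  (forall x, 0 < v1 x <= Num.sqrt 2) -> (forall x, 0 < v2 x <= Num.sqrt 2) ->
  v1 0 = v2 0 -> d1 0 = d2 0 -> forall x, 0 <= x -> v1 x = v2 x.
Proof.
move=> e0 dv1 dv2 dd1 dd2 b1 b2 h0 h1 x x0.
have [L L0 hL] := force_lipschitz e e0.
pose phi (y : R) : R := (v1 y - v2 y) ^+ 2 + (d1 y - d2 y) ^+ 2.
have : phi x = 0.
  apply: (@gronwall0 phi (fun y => 2 * (v1 y - v2 y) * (d1 y - d2 y) +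
     2 * (d1 y - d2 y) * (force e (v1 y) - force e (v2 y))) (1 + L)) => //.
  - move=> y; rewrite /phi; apply: hderivD; apply: hderiv_sqr.
      exact: (hderivB _ _ _ _ _ (dv1 y) (dv2 y)).
    exact: (hderivB _ _ _ _ _ (dd1 y) (dd2 y)).
  - by move=> y; rewrite addr_ge0// sqr_ge0.
  - move=> y; have := hL _ _ (b1 y) (b2 y); rewrite /phi.
    move: (v1 y - v2 y) (d1 y - d2 y) (force _ _ - _) => p q r hr.
    have h2 : 2 * q * r <= L * (p ^+ 2 + q ^+ 2).
      apply: (@le_trans _ _ (2 * `|q| * (L * `|p|))).
        apply: (le_trans (ler_norm _)); rewrite !normrM (ger0_norm (x := 2))//.
        by rewrite ler_wpM2l// mulr_ge0.
      have -> : 2 * `|q| * (L * `|p|) = L * (2 * `|q| * `|p|) by ring.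
      rewrite ler_wpM2l// -(real_normK (num_real p)) -(real_normK (num_real q)).
      by have := sqr_ge0 (`|p| - `|q|); nra.
    by have := sqr_ge0 (p - q); nra.
  - by rewrite /phi h0 h1 !subrr expr0n addr0.
move/eqP; rewrite paddr_eq0 ?sqr_ge0// sqrf_eq0 subr_eq0 => /andP[/eqP]//.
Qed.

Lemma ode_unique e (v1 v2 d1 d2 : R -> R) : e != 0 ->
  (forall x, is_derive x 1 v1 (d1 x)) -> (forall x, is_derive x 1 v2 (d2 x)) ->
  (forall x, is_derive x 1 d1 (force e (v1 x))) ->
  (forall x, is_derive x 1 d2 (force e (v2 x))) ->
  (forall x, 0 < v1 x <= Num.sqrt 2) -> (forall x, 0 < v2 x <= Num.sqrt 2) ->
  v1 0 = v2 0 -> d1 0 = d2 0 -> forall x, v1 x = v2 x.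
Proof.
move=> e0 dv1 dv2 dd1 dd2 b1 b2 h0 h1 x.
have [x0|x0] := leP 0 x; first exact: (ode_unique_right e v1 v2 d1 d2).
have dref (f g : R -> R) : (forall x, is_derive x 1 f (g x)) ->
    forall x, is_derive x 1 (fun y => f (- y)) (- g (- x)).
  move=> df y; apply: is_derive_hderiv.
    exact: (hderiv_comp f _ _ _ _ (df (- y)) (hderivN _ _ _ (hderiv_id y))).
  by rewrite mulrN1.
rewrite -[x]opprK.
apply: (ode_unique_right e (fun y => v1 (- y)) (fun y => v2 (- y))
  (fun y => - d1 (- y)) (fun y => - d2 (- y))) => //.
- by move=> y; apply: is_derive_hderiv;
  [exact: (hderivN _ _ _ (dref _ _ dd1 y))|rewrite opprK].
- by move=> y; apply: is_derive_hderiv;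
  [exact: (hderivN _ _ _ (dref _ _ dd2 y))|rewrite opprK].
- by rewrite oppr0.
- by rewrite oppr0 h1.
- by rewrite oppr_ge0 ltW.
Qed.

(** * Classification of an arbitrary solitary wave *)

Section wave.
Variables (e : R) (v : R -> R).
Hypotheses (ep : 0 < e) (hv : solitary_wave e v).

Let e0 : e != 0. Proof. by rewrite gt_eqF. Qed.
Let dv := v^`()%classic.

Lemma wave_derive x : is_derive x 1 v (dv x).
Proof.
have [sv _ _ _ _] := hv; split; first exact: (sv 0%N x).
by rewrite /dv derive1E.
Qed.
Lemma wave_derive2 x : is_derive x 1 dv (force e (v x)).
Proof.
have [sv ov _ _ _] := hv; split; first by have := sv 1%N x; rewrite derive1n1.
by have := ov x; rewrite derive1nS derive1n1 -derive1E.
Qed.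
Lemma wave_bounds x : 0 < v x <= Num.sqrt 2.
Proof. by have [_ _ _ _] := hv. Qed.

(* The conserved quantity cannot be negative since it is minus the energy at
   infinity up to a square, nor positive since then [`|dv|] would be bounded
     below. *)
Lemma wave_energy x : dv x ^+ 2 = energy e (v x).
Proof.
pose E (y : R) : R := dv y ^+ 2 - energy e (v y).
have dE (y : R) : is_derive y 1 E 0.
  rewrite /E; apply: is_derive_hderiv.
    apply: hderivB; first exact: (hderiv_sqr _ _ _ (wave_derive2 y)).
    exact: (hderiv_comp _ _ _ _ _ (is_derive_energy e _ e0) (wave_derive y)).
  by ring.
have Ec y : E y = E 0 by exact: is_derive_0_is_cst.
have en y : 0 <= energy e (v y).
  by apply: energy_ge0; have /andP[h1 h2] := wave_bounds y; rewrite h2 ltW.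
have vy : v y @[y --> +oo] --> (0 : R) by have [] := hv.
suff E0 : E 0 = 0 by have := Ec x; rewrite E0 /E => /eqP;
  rewrite subr_eq0 => /eqP.
have [En|Ep|//] := ltgtP (E 0) 0.
- have c : energy e (v y) @[y --> +oo] --> (0 : R).
    have ce : {for 0, continuous (energy e)}.
      exact: is_derive_continuous (is_derive_energy e 0 e0).
    have -> : (0 : R) = energy e 0.
      by rewrite /energy expr0n/= subr0 expr1n divff ?onePsqr_neq0// ln1 oppr0
        mul0r.
    exact: cvg_comp vy ce.
  have En' : 0 < - E 0 by rewrite oppr_gt0.
  have [M [_ hM]] := cvgr_lt 0 c _ En'.
  have h : energy e (v (M + 1)) < - E 0 by apply: hM; rewrite ltrDl.
  have := Ec (M + 1); have := sqr_ge0 (dv (M + 1)); rewrite /E.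
  move: h; rewrite /E; lra.
- have h y : E 0 <= dv y ^+ 2 by rewrite -(Ec y) /E lerBlDr lerDl.
  have s0 : 0 < Num.sqrt (E 0) by rewrite sqrtr_gt0.
  have s2 : 0 < Num.sqrt (E 0) / 2 by rewrite divr_gt0.
  have hs y : Num.sqrt (E 0) <= `|dv y|.
    by rewrite -sqrtr_sqr ler_wsqrtr.
  have [M [_ hM]] := cvgr_lt 0 vy _ s2.
  have v1 := hM (M + 1); have v2 := hM (M + 2).
  have l1 : v (M + 1) < Num.sqrt (E 0) / 2 by apply: v1; rewrite ltrDl.
  have l2 : v (M + 2) < Num.sqrt (E 0) / 2 by apply: v2; rewrite ltrDl.
  (* Both end values lie between [0] and half of [sqrt (E 0)], so over this interval of length [1]
     the mean slope is too small for the lower bound [hs]. *)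
  have [c _ hc] : exists2 c, c \in `](M + 1), (M + 2)[%R &
      v (M + 2) - v (M + 1) = dv c * ((M + 2) - (M + 1)).
    apply: MVT; [lra|by move=> y _; exact: wave_derive|].
    apply: continuous_subspaceT; apply: continuous_atP => y.
    exact: is_derive_continuous (wave_derive y).
  have /andP[p1 _] := wave_bounds (M + 1); have /andP[p2 _] :=
    wave_bounds (M + 2).
  have : `|dv c| < Num.sqrt (E 0).
    rewrite -[dv c]mulr1 (_ : 1 = (M + 2) - (M + 1)); last by ring.
    by rewrite -hc ltr_norml; lra.
  by rewrite ltNge hs.
Qed.

(** Since [v 0] is positive and [v] tends to [0] on both sides, [v] stays below [v 0] outside some
    compact interval. *)
Lemma wave_max : exists a, forall x, v x <= v a.
Proof.
have [_ _ vy vNy _] := hv; have /andP[v0 _] := wave_bounds 0.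
have [M1 [_ h1]] := cvgr_lt 0 vy _ v0.
have [M2 [_ h2]] := cvgr_lt 0 vNy _ v0.
pose M := Num.max `|M1| `|M2| + 1.
have M0 : 0 < M by rewrite /M ltr_wpDl// le_max normr_ge0.
have hM1 : M1 < M.
  by rewrite /M ltr_pwDr// le_max; apply/orP; left; exact: ler_norm.
have hM2 : - M < M2.
  rewrite ltrNl /M ltr_pwDr// le_max; apply/orP; right.
  by rewrite -normrN ler_norm.
have [||a _ ha] := @EVT_max R v (- M) M.
- lra.
- apply: continuous_subspaceT; apply: continuous_atP => y.
  exact: is_derive_continuous (wave_derive y).
have h0 : v 0 <= v a by apply: ha; rewrite in_itv/=; lra.
exists a => x; have [xM|xM] := leP x M; last first.
  by apply: le_trans h0; apply: ltW; apply: h1; exact: lt_trans xM.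
have [xN|xN] := leP (- M) x; first by apply: ha; rewrite in_itv/= xN.
by apply: le_trans h0; apply: ltW; apply: h2; exact: lt_trans hM2.
Qed.

Lemma wave_eq_usol a : (forall x, v x <= v a) -> forall x, v x = usol e (x - a).
Proof.
move=> ha.
have da : dv a = 0.
  have h : is_derive a 1 v 0.
    apply: (@derive1_at_max _ v (a - 1) (a + 1)) => //.
    - lra.
    - by move=> t _; have [] := wave_derive t.
    - by rewrite in_itv/=; lra.
  by have [_ <-] := wave_derive a; have [_ ->] := h.
have va : v a = Num.sqrt 2.
  have /andP[v0 vs] := wave_bounds a.
  apply/eqP; rewrite eq_le vs leNgt; apply/negP => h.
  have := energy_gt0 e (v a); rewrite v0 h => /(_ isT (denom_gt0 e _ e0)).
  by rewrite -wave_energy da expr0n ltxx.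
move=> x.
suff h y : v (y + a) = usol e y by rewrite -h subrK.
have dsh (f g : R -> R) : (forall x, is_derive x 1 f (g x)) ->
    forall x, is_derive x 1 (fun y => f (y + a)) (g (x + a)).
  move=> df z; apply: is_derive_hderiv.
    exact: (hderiv_comp f (fun y => y + a) z _ _ (df (z + a))
      (hderivD (fun y => y) (fun _ => a) z _ _ (hderiv_id z) (hderiv_cst z a))).
  by rewrite addr0 mulr1.
apply: (ode_unique e (fun y => v (y + a)) (usol e) (fun y => dv (y + a))
  (dsol e)) => //.
- exact: dsh wave_derive.
- by move=> z; apply: is_derive_usol; exact: stretch_gt0_eps.
- exact: dsh wave_derive2.
- by move=> z; exact: is_derive_dsol.
- by move=> z; exact: wave_bounds.
- by move=> z; rewrite usol_gt0 usol_le.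
- by rewrite add0r va usol0.
- by rewrite add0r da /dsol sgr0 oppr0 mul0r.
Qed.

End wave.

End ode.

(** * Weak derivatives and the integral of the energy *)

Section weak.
Context {R : realType}.
Implicit Types (f g phi : R -> R).
Notation mu := (@lebesgue_measure R).

Lemma continuous_integrable_itv f a b : continuous f ->
  mu.-integrable `[a, b] (EFin \o f).
Proof.
move=> cf; apply: continuous_compact_integrable; first exact: segment_compact.
exact: continuous_subspaceT.
Qed.

Lemma continuous_locally_integrable f : continuous f ->
  locally_integrable setT f.
Proof.
move=> cf; split; [exact: continuous_measurable_fun|exact: openT|].
move=> K _ cK.
have /integrableP[_] : mu.-integrable K (EFin \o f).
  by apply: continuous_compact_integrable => //; exact: continuous_subspaceT.
by [].
Qed.

Lemma test_function_support phi : test_function phi ->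
  exists2 N, 0 < N & forall x, N < `|x| -> phi x = 0 /\ phi^`()%classic x = 0.
Proof.
move=> [sphi cphi]; have [M [_ hM]] := compact_bounded cphi.
pose N := `|M| + 1.
have MN : M < N by rewrite /N (le_lt_trans (ler_norm M))// ltrDl.
have z x : N < `|x| -> phi x = 0.
  move=> Nx; apply/eqP/negPn/negP => h.
  have : `|x| <= N by apply: hM => //; apply: subset_closure.
  by rewrite leNgt Nx.
exists N; first by rewrite /N ltr_wpDl.
move=> x Nx; split; first exact: z.
have h : is_derive x 1 phi 0.
  apply: (near_eq_is_derive _ (is_derive_cst (0 : R) x (1 : R))).
  exists (`|x| - N); first by rewrite /= subr_gt0.
  move=> y /= hy; rewrite z//.
  have : `|x| <= `|x - y| + `|y| by rewrite -{1}(subrK y x) ler_normD.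
  by lra.
by rewrite derive1E; have [_ ->] := h.
Qed.

(** Integration by parts on an interval containing the support of the test function. At the points
    of [s] the slope [g] may be infinite in the limit; continuity of [f] there prevents a jump
    term. *)
Lemma weak_derivative_off (s : seq R) f g : continuous f ->
  (forall x, x \notin s -> is_derive x 1 f (g x)) ->
  (forall x, x \notin s -> {for x, continuous g}) ->
  locally_integrable setT g -> weak_derivative f g.
Proof.
move=> cf df cg lg; split => //; first exact: continuous_locally_integrable.
move=> phi tphi; have [N N0 hN] := test_function_support phi tphi.
have [sphi _] := tphi.
have dphi (x : R) : is_derive x 1 phi (phi^`()%classic x).
  by split; [exact: (sphi 0%N x)|rewrite derive1E].
have cphi : continuous phi by move=> x; exact: is_derive_continuous (dphi x).
have cphi' : continuous (phi^`()%classic).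
  move=> x; have h := sphi 1%N x; rewrite derive1n1 in h.
  exact/differentiable_continuous/derivable1_diffP.
(* The endpoints are strictly beyond the support, so the boundary terms vanish. *)
pose M := N + 1.
have restr (h : R -> R) : (forall x, N < `|x| -> h x = 0) ->
    \int[mu]_x h x = \int[mu]_(x in `[- M, M]) h x.
  move=> h0; rewrite [RHS]Rintegral_mkcond; apply: eq_Rintegral => x _.
  rewrite patchE; case: ifPn => //; rewrite notin_setE/= in_itv/= -ler_norml =>
    /negP.
  by rewrite -ltNge /M => h1; apply: h0; apply: lt_trans h1; rewrite ltrDl.
rewrite restr; last by move=> x /hN[_ ->]; rewrite mulr0.
rewrite [in RHS]restr; last by move=> x /hN[-> _]; rewrite mulr0.
have [mg _ hK] := lg.
have ig : mu.-integrable `[- M, M] (EFin \o g).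
  apply/integrableP; split.
    by apply/measurable_EFinP; exact: measurable_funTS.
  by apply: hK => //; exact: segment_compact.
have igp : mu.-integrable `[- M, M] (EFin \o (fun x => g x * phi x)).
  have := @integrableMl _ _ _ mu `[- M, M]%classic (measurable_itv _)
    (EFin \o g) phi ig.
  apply; first exact: measurable_funTS (continuous_measurable_fun cphi).
  have /compact_bounded[r [_ hr]] :=
    continuous_compact (continuous_subspaceT cphi) (@segment_compact _ (- M) M).
  by exists r; split; [exact: num_real|move=> t rt x Ax; apply: hr => //;
    exists x].
have ifp : mu.-integrable `[- M, M]
  (EFin \o (fun x => f x * phi^`()%classic x)).
  apply: continuous_integrable_itv; apply: continuous_atP => x;
    apply: continuous_atM; [exact: cf|exact: cphi'].
have NM : N < `|M|.
  by rewrite /M gtr0_norm ?ltrDl// addr_gt0.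
have : \int[mu]_(x in `[- M, M]) (g x * phi x + f x * phi^`()%classic x) =
    f M * phi M - f (- M) * phi (- M).
  apply: (@integrable_FTC _ s _ (fun x => f x * phi x)).
  - by rewrite /M; lra.
  - exact: (@integrableD _ _ _ mu _ (measurable_itv _) _ _ igp ifp).
  - apply: continuous_subspaceT; apply: continuous_atP => x;
    apply: continuous_atM; [exact: cf|exact: cphi].
  - move=> x _ xs; exact: (hderivM _ _ _ _ _ (df x xs) (dphi x)).
  - move=> x _ xs; apply: continuous_atD; apply: continuous_atM;
    [exact: cg|exact: cphi|exact: cf|exact: cphi'].
have NM' : N < `|- M| by rewrite normrN.
rewrite (hN M NM).1 (hN (- M) NM').1 !mulr0 subrr.
by rewrite RintegralD// => /eqP; rewrite addrC addr_eq0 => /eqP.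
Qed.

End weak.

(** * The integral of the squared slope *)

Section energy_integral.
Context {R : realType}.
Implicit Types (t u x y e z : R).
Notation mu := (@lebesgue_measure R).

Definition sqrt_energy e u : R := Num.sqrt (energy e u).

Lemma measurable_energy (f : R -> R) e : continuous f ->
  measurable_fun setT (fun x => energy e (f x)).
Proof.
move=> cf.
have m1 : measurable_fun setT (fun u : R => ((1 - f u ^+ 2) ^+ 2 + e ^+ 2) /
  (1 + e ^+ 2)).
  apply: continuous_measurable_fun; apply: continuous_atP => u.
  by have cu : {for u, continuous f} := cf u; continuous_rules;
    exact: onePsqr_neq0.
have m2 := measurableT_comp (@measurable_ln R) m1.
have co : continuous (fun x : R => - x) by apply: continuous_atP => x;
  continuous_rules.
have m3 := measurableT_comp (continuous_measurable_fun co) m2.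
exact: (measurable_funM m3 (measurable_cst (2^-1 : R))).
Qed.

Lemma measurable_sqrt_energy e : measurable_fun setT (sqrt_energy e).
Proof.
have me : measurable_fun setT (fun x : R => energy e x).
  by apply: (measurable_energy (fun x => x)); apply: continuous_atP => x;
    exact: continuous_at_id.
exact: (measurableT_comp (continuous_measurable_fun (@sqrt_continuous R)) me).
Qed.

Lemma sqrt_energy_ge0 e u : 0 <= sqrt_energy e u. Proof. exact: sqrtr_ge0. Qed.

Lemma sqrt_energy_continuous e u : 0 < denom e u ->
  {for u, continuous (sqrt_energy e)}.
Proof.
move=> d0; rewrite /sqrt_energy /energy; apply: continuous_at_sqrt;
  apply: continuous_atM; last exact: continuous_at_cst.
by apply: continuous_atN; apply: continuous_at_ln;
  [rewrite divr_gt0 ?onePsqr_gt0|continuous_rules; exact: onePsqr_neq0].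
Qed.

Lemma denom0_gt0 e u : 0 < u -> u != 1 -> 0 < denom e u.
Proof.
move=> u0 u1; rewrite /denom ltr_wpDr ?sqr_ge0// lt0r sqr_ge0 andbT.
rewrite sqrf_eq0 subr_eq0 eq_sym sqrf_eq1 (negbTE u1)/=.
by apply: contraTneq u0 => ->; rewrite -leNgt lerN10.
Qed.

(** An explicitly integrable majorant of [sqrt_energy 0]. With [r = sqrt |1 - u^2|] the energy is
    [2 * ln (1 / r) <= 2 / r], and [r >= sqrt |1 - u|]; then [sqrt p <= 1 + p]. *)
Definition logbound u : R := 1 + 2 / Num.sqrt `|1 - u|.

Lemma sqrt_energy0_le u : 0 <= u -> u != 1 -> sqrt_energy 0 u <= logbound u.
Proof.
move=> u0 u1.
have b0 : 0 <= 2 / Num.sqrt `|1 - u| by rewrite divr_ge0 ?sqrtr_ge0.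
have h : energy 0 u <= 2 / Num.sqrt `|1 - u|.
  pose r := Num.sqrt `|1 - u ^+ 2|.
  have z0 : 0 < `|1 - u ^+ 2|.
    have -> : 1 - u ^+ 2 = (1 - u) * (1 + u) by ring.
    rewrite normr_gt0 mulf_neq0//; first by rewrite subr_eq0 eq_sym.
    by rewrite gt_eqF// ltr_pwDl.
  have r0 : 0 < r by rewrite sqrtr_gt0.
  have -> : energy 0 u = 2 * ln r^-1.
    rewrite /energy expr0n/= !addr0 divr1 lnV ?posrE//.
    have -> : (1 - u ^+ 2) ^+ 2 = r ^+ 4.
      rewrite (_ : r ^+ 4 = (r ^+ 2) ^+ 2); last by ring.
      by rewrite /r sqr_sqrtr// real_normK// num_real.
    by rewrite lnXn// -mulr_natr; field.
  rewrite ler_pM2l//; apply: (le_trans (ltW (ln_sublinear _)));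
    first by rewrite invr_gt0.
  have n0 : 0 < Num.sqrt `|1 - u| by rewrite sqrtr_gt0 normr_gt0 subr_eq0
    eq_sym.
  rewrite lef_pV2 ?posrE//; apply: ler_wsqrtr; have -> : 1 - u ^+ 2 =
    (1 - u) * (1 + u) by ring.
  by rewrite normrM ler_peMr// ger0_norm ?lerDl// addr_ge0.
have [E0|E0] := leP 0 (energy 0 u); last first.
  by rewrite /sqrt_energy ltr0_sqrtr// /logbound addr_ge0.
rewrite /logbound; apply: (@le_trans _ _ (1 + energy 0 u));
  last by rewrite lerD2l.
have : sqrt_energy 0 u ^+ 2 = energy 0 u by rewrite sqr_sqrtr.
by move=> <-; have := sqrt_energy_ge0 0 u; move: (sqrt_energy 0 u) => p; nra.
Qed.

Lemma logbound_integrable : mu.-integrable `[0, 2] (EFin \o logbound).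
Proof.
(* [Num.sqrt] is [0] on negative numbers, so [F] is a primitive on both sides of 1. *)
pose F (u : R) : R := u - 4 * Num.sqrt (1 - u) + 4 * Num.sqrt (u - 1).
have [|||||h _] := @ge0_FTC R [:: 1] logbound F 0 2.
- exact: ler0n.
- by move=> u; rewrite /logbound addr_ge0// divr_ge0 ?sqrtr_ge0.
- by apply: continuous_subspaceT; apply: continuous_atP => u; rewrite /F;
  continuous_rules.
- move=> u _; rewrite inE => u1.
  have [ul|ug|] := ltgtP u 1; last by move/eqP; rewrite (negbTE u1).
    have p0 : 0 < 1 - u by rewrite subr_gt0.
    have hd : is_derive u 1 (fun y : R => y - 4 * Num.sqrt (1 - y))
      (logbound u).
      apply: is_derive_hderiv.
        apply: hderivB; first exact: hderiv_id.
        apply: (hderivM (fun _ => 4) (fun y => Num.sqrt (1 - y))); first exact: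
          hderiv_cst.
        exact: (hderiv_sqrt (fun y : R => 1 - y) u _ p0
          (hderivB _ _ _ _ _ (hderiv_cst u 1) (hderiv_id u))).
      by rewrite /logbound gtr0_norm//=; field; rewrite gt_eqF// sqrtr_gt0.
    apply: near_eq_is_derive hd; near=> y.
    have y1 : y < 1 by near: y; exact: lt_nbhsl.
    by rewrite /F [X in _ = _ + 4 * X]ltr0_sqrtr ?subr_lt0// mulr0 addr0.
  have p0 : 0 < u - 1 by rewrite subr_gt0.
  have hd : is_derive u 1 (fun y : R => y + 4 * Num.sqrt (y - 1)) (logbound u).
    apply: is_derive_hderiv.
      apply: hderivD; first exact: hderiv_id.
      apply: (hderivM (fun _ => 4) (fun y => Num.sqrt (y - 1))); first exact:
        hderiv_cst.
      exact: (hderiv_sqrt (fun y : R => y - 1) u _ p0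
        (hderivB _ _ _ _ _ (hderiv_id u) (hderiv_cst u 1))).
    by rewrite /logbound distrC gtr0_norm//=; field; rewrite gt_eqF// sqrtr_gt0.
  apply: near_eq_is_derive hd; near=> y.
  have y1 : 1 < y by near: y; exact: lt_nbhsr.
  by rewrite /F [Num.sqrt (1 - y)]ltr0_sqrtr ?subr_lt0// mulr0 subr0.
- move=> u _; rewrite inE => u1; rewrite /logbound.
  apply: continuous_atD; first exact: continuous_at_cst.
  apply: continuous_atM; first exact: continuous_at_cst.
  apply: continuous_atV; first by rewrite gt_eqF// sqrtr_gt0 normr_gt0 subr_eq0
    eq_sym.
  apply: continuous_at_sqrt;
    apply: (continuous_at_comp Num.norm (fun y => 1 - y));
    first by continuous_rules.
  exact: norm_continuous.
exact: h.
Unshelve. all: by end_near. Qed.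

(** On this range [w = (1 - u^2)^2] is at most [1], so [(w + e^2) / (1 + e^2) >= w]. At [u = 1] the
    default value of [energy 0] is [0] and the comparison would fail for [e != 0]. *)
Lemma energy_le0 e u : 0 <= u <= Num.sqrt 2 -> u != 1 -> energy e u <=
  energy 0 u.
Proof.
move=> /andP[u0 us] u1; rewrite /energy ler_pM2r ?invr_gt0// lerN2 expr0n/=
  !addr0 divr1.
have a0 : 0 < (1 - u ^+ 2) ^+ 2.
  rewrite lt0r sqr_ge0 andbT sqrf_eq0 subr_eq0 eq_sym sqrf_eq1 (negbTE u1)/=.
  by apply: contraTneq u0 => ->; rewrite -ltNge ltrN10.
rewrite ler_ln ?posrE//; last by rewrite divr_gt0 ?onePsqr_gt0// ltr_wpDr//
  sqr_ge0.
rewrite ler_pdivlMr ?onePsqr_gt0// mulrDr mulr1 lerD2l ler_piMl ?sqr_ge0//.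
have u2 : u ^+ 2 <= 2 by rewrite -sqrt2_sqr ler_pXn2r ?nnegrE ?(ltW sqrt2_gt0).
have : 0 <= u ^+ 2 by exact: sqr_ge0.
by move: (u ^+ 2) u2 => v v2 v0; nra.
Qed.

Lemma ae_off_one (P : R -> Prop) : (forall u, u != 1 -> P u) ->
  {ae mu, forall u, P u}.
Proof.
move=> h; exists [set 1]; split => //; first exact: lebesgue_measure_set1.
move=> u /= nP; apply/eqP/negPn/negP => u1; exact/nP/h.
Qed.

(** The interval extends past [sqrt 2] so that [sqrt 2], the value at the top of the wave, is an
    interior point for the primitive. *)
Lemma sqrt_energy_integrable e : mu.-integrable `[0, 2] (EFin \o sqrt_energy e).
Proof.
have [->|e0] := eqVneq e 0; last first.
  apply: continuous_integrable_itv; apply: continuous_atP => u.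
  by apply: sqrt_energy_continuous; exact: denom_gt0.
have m := measurable_sqrt_energy 0.
have m2 : measurable_fun `[0 : R, 2] (EFin \o sqrt_energy 0).
  by apply/measurable_EFinP; exact: measurable_funTS.
have m3 := measurable_int mu logbound_integrable.
have b0 u : 0 <= logbound u.
  by rewrite /logbound addr_ge0// divr_ge0 ?sqrtr_ge0.
apply/integrableP; split => //.
have /integrableP[_] := logbound_integrable; apply: le_lt_trans.
apply: ae_ge0_le_integral => //.
- exact: measurableT_comp.
- exact: measurableT_comp.
apply: ae_off_one => u u1 /=; rewrite in_itv/= => /andP[u0 _].
by rewrite lee_fin !ger0_norm ?sqrt_energy_ge0// sqrt_energy0_le.
Qed.

Definition sqrt_energy_int e u : R := \int[mu]_(x in `[0, u]) sqrt_energy e x.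

Lemma sqrt_energy_int_continuous e u : 0 < u < 2 ->
  {for u, continuous (sqrt_energy_int e)}.
Proof.
move=> u02.
have h : {within `[0, 2],
  continuous (fun x => parameterized_integral mu 0 x (sqrt_energy e))}.
  by apply: parameterized_integral_continuous;
    [exact: ler0n|exact: sqrt_energy_integrable].
have [|c _ _] := (continuous_within_itvP (fun x => parameterized_integral mu 0 x
  (sqrt_energy e)) _).1 h.
  by rewrite ltr0n.
by apply: c; rewrite in_itv.
Qed.

Lemma sqrt_energy_int_cvg0 e : sqrt_energy_int e x @[x --> 0^'+] --> (0 : R).
Proof.
have h : {within `[0, 2],
  continuous (fun x => parameterized_integral mu 0 x (sqrt_energy e))}.
  by apply: parameterized_integral_continuous;
    [exact: ler0n|exact: sqrt_energy_integrable].
have [|_ c _] := (continuous_within_itvP (fun x => parameterized_integral mu 0 x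
  (sqrt_energy e)) _).1 h.
  by rewrite ltr0n.
by move: c; rewrite {2}/parameterized_integral set_itv1 Rintegral_set1.
Qed.

Lemma is_derive_sqrt_energy_int e u : 0 < u < 2 -> 0 < denom e u ->
  is_derive u 1 (sqrt_energy_int e) (sqrt_energy e u).
Proof.
move=> /andP[u0 u2] d0.
have [||h1 h2] := @continuous_FTC1 R (sqrt_energy e) (BLeft 0) u 2 u2
  (sqrt_energy_integrable e).
- exact: u0.
- exact: sqrt_energy_continuous.
apply: DeriveDef; first exact: h1.
by rewrite -derive1E; exact: h2.
Qed.

Lemma usol_lt2 e x : usol e x < 2.
Proof. exact: le_lt_trans (usol_le e x) sqrt2_lt2. Qed.

Lemma usol_neq1 e x : x \notin [:: crest e; - crest e] -> usol e x != 1.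
Proof.
rewrite !inE negb_or => /andP[h1 h2]; apply/eqP => E.
have h : `|x| = crest e.
  rewrite /crest -E -usol_norm /usol sech_profK ?param_ge0// paramK//.
by have [x0|x0] := leP 0 x; [move: h1; rewrite -h ger0_norm// eqxx|
  move: h2; rewrite -h ltr0_norm// opprK eqxx].
Qed.

(** On one side of the origin [u' = - c * sqrt P], so [u'^2 dx = - c * sqrt P du]. The parameter [c]
    treats both sides at once. *)
Lemma energy_integral_half e (c a b : R) : a <= b -> c ^+ 2 = 1 ->
  (forall x, a < x < b -> Num.sg x = c) ->
  mu.-integrable `[a, b] (EFin \o (fun x => energy e (usol e x))) /\
  (\int[mu]_(x in `[a, b]) (energy e (usol e x))%:E =
   (c * (sqrt_energy_int e (usol e a) - sqrt_energy_int e (usol e b)))%:E)%E.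
Proof.
move=> ab c1 sgc.
have cQ x : {for x, continuous (fun x => - c * sqrt_energy_int e (usol e x))}.
  apply: continuous_atM; first exact: continuous_at_cst.
  apply: continuous_at_comp; first exact: continuous_usol.
  by apply: sqrt_energy_int_continuous; rewrite usol_gt0 usol_lt2.
have [||||h1 h2] := @ge0_FTC R [:: crest e; - crest e]
   (fun x => energy e (usol e x)) (fun x => - c * sqrt_energy_int e (usol e x))
     a b ab.
- by move=> x; exact: energy_usol_ge0.
- exact: continuous_subspaceT.
- move=> x xab xs; have u1 := usol_neq1 e x xs.
  have d0 := denom0_gt0 e (usol e x) (usol_gt0 e x) u1.
  have k0 : 0 < stretch e (param e x) by apply: stretch_gt0.
  apply: is_derive_hderiv.
    apply: (hderivM (fun _ => - c)); first exact: hderiv_cst.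
    apply: (hderiv_comp (sqrt_energy_int e)); last exact: is_derive_usol k0.
    by apply: is_derive_sqrt_energy_int; rewrite // usol_gt0 usol_lt2.
  rewrite mul0r add0r /dsol -/(sqrt_energy _ _) (sgc x xab).
  have := sqr_sqrtr (energy_usol_ge0 e x); rewrite -/(sqrt_energy _ _) => <-.
  by transitivity (c ^+ 2 * sqrt_energy e (usol e x) ^+ 2);
    [ring|rewrite c1 mul1r].
- move=> x xab xs; have u1 := usol_neq1 e x xs.
  have d0 := denom0_gt0 e (usol e x) (usol_gt0 e x) u1.
  apply: continuous_at_comp; first exact: continuous_usol.
  rewrite /energy; apply: continuous_atM; last exact: continuous_at_cst.
  by apply: continuous_atN; apply: continuous_at_ln;
    [rewrite divr_gt0 ?onePsqr_gt0|continuous_rules; exact: onePsqr_neq0].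
split; first exact: h1.
rewrite h2; congr EFin; move: (sqrt_energy_int _ _) (sqrt_energy_int _ _) =>
  p q; ring.
Qed.

Lemma energy_integral_itv e (M : R) : 0 < M ->
  (\int[mu]_(x in `[(- M)%R, M]) (energy e (usol e x))%:E =
   (2 * (sqrt_energy_int e (Num.sqrt 2) - sqrt_energy_int e (usol e M)))%:E)%E.
Proof.
move=> M0.
have [i1 e1] : mu.-integrable `[- M, 0] (EFin \o (fun x => energy e (usol e x)))
  /\
    (\int[mu]_(x in `[(- M)%R, 0%R]) (energy e (usol e x))%:E =
   (-1 * (sqrt_energy_int e (usol e (- M)) - sqrt_energy_int e
     (usol e 0)))%:E)%E.
  apply: energy_integral_half; [by rewrite oppr_le0 ltW|by rewrite sqrrN expr1n|
    ].
  by move=> x /andP[_ x0]; rewrite ltr0_sg.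
have [i2 e2] : mu.-integrable `[0, M] (EFin \o (fun x => energy e (usol e x)))
  /\
    (\int[mu]_(x in `[0%R, M]) (energy e (usol e x))%:E =
   (1 * (sqrt_energy_int e (usol e 0) - sqrt_energy_int e (usol e M)))%:E)%E.
  apply: energy_integral_half; [exact: ltW|by rewrite expr1n|].
  by move=> x /andP[x0 _]; rewrite gtr0_sg.
have m1 := measurable_int mu i1; have m2 := measurable_int mu i2.
have m2' : measurable_fun `]0, M] (EFin \o (fun x => energy e (usol e x))).
  by apply: measurable_funS m2 => //; exact: subset_itv_oc_cc.
have -> : `[- M, M]%classic = `[- M, 0]%classic `|` `]0, M]%classic.
  by apply: itv_bndbnd_setU; rewrite bnd_simp ?oppr_le0 ltW.
have mU : measurable_fun (`[- M, 0] `|` `]0, M])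
  (EFin \o (fun x => energy e (usol e x))).
  exact/measurable_funU.
have dU : [disjoint `[- M, 0]%classic & `]0, M]%classic].
  apply/disj_set2P; rewrite -subset0 => z/=; rewrite !in_itv/= => -[/andP[_]].
  by rewrite leNgt => /negbTE ->.
rewrite (@ge0_integral_setU _ _ _ mu _ _ (measurable_itv _) (measurable_itv _) _
  mU _ dU).
  rewrite /comp e1 integral_itv_obnd_cbnd; last exact: m2'.
  rewrite e2 usolN usol0 -EFinD; congr EFin.
  move: (sqrt_energy_int _ _) (sqrt_energy_int _ _) => p q; ring.
by move=> x _; rewrite lee_fin energy_usol_ge0.
Qed.

Lemma measurable_energy_usol e :
  measurable_fun setT (fun x => energy e (usol e x)).
Proof. exact: measurable_energy (@continuous_usol R e). Qed.

Lemma energy_integral e :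
  (\int[mu]_x (energy e (usol e x))%:E =
    (2 * sqrt_energy_int e (Num.sqrt 2))%:E)%E.
Proof.
have h1 := cvg_integral_setT _ (measurable_energy_usol e) (energy_usol_ge0 e).
apply: (cvg_unique _ h1) => //.
have h2 : (2 * (sqrt_energy_int e (Num.sqrt 2) - sqrt_energy_int e
  (usol e n%:R)))%:E @[n --> \oo] -->
    (2 * sqrt_energy_int e (Num.sqrt 2))%:E.
  apply: cvg_EFin; first by near=> n.
  have hq : sqrt_energy_int e (usol e n%:R) @[n --> \oo] --> (0 : R).
    have := @sqrt_energy_int_cvg0 e => /cvg_at_rightP; apply; split => [n|];
      first exact: usol_gt0.
    exact: (cvg_comp _ _ (@cvgr_idn R) (usol_cvgy e)).
  have -> : 2 * sqrt_energy_int e (Num.sqrt 2) =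
    2 * (sqrt_energy_int e (Num.sqrt 2) - 0) by rewrite subr0.
  by apply: cvgM; [exact: cvg_cst|apply: cvgB; [exact: cvg_cst|exact: hq]].
apply: cvg_trans h2; apply: near_eq_cvg; near=> n.
by rewrite energy_integral_itv// ltr0n; near: n; exact: nbhs_infty_gt.
Unshelve. all: by end_near. Qed.

Lemma sqrt_energy_int_le e : sqrt_energy_int e (Num.sqrt 2) <=
  sqrt_energy_int 0 (Num.sqrt 2).
Proof.
have sub : `[0, Num.sqrt 2] `<=` `[0, (2 : R)].
  by apply: subset_itvScc => //; rewrite bnd_simp ltW// sqrt2_lt2.
have i1 (d : R) : mu.-integrable `[0, Num.sqrt 2] (EFin \o sqrt_energy d).
  exact: integrableS (sqrt_energy_integrable d).
rewrite /sqrt_energy_int /Rintegral; apply: fine_le.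
- exact: integrable_fin_num (i1 e).
- exact: integrable_fin_num (i1 0).
apply: ae_ge0_le_integral; first exact: measurable_itv.
- by move=> x _; rewrite lee_fin sqrt_energy_ge0.
- exact: measurable_int (i1 e).
- by move=> x _; rewrite lee_fin sqrt_energy_ge0.
- exact: measurable_int (i1 0).
apply: ae_off_one => u u1 /=; rewrite in_itv/= => us.
by rewrite lee_fin /sqrt_energy ler_wsqrtr// energy_le0.
Qed.

Lemma energy_integral_le e :
  (\int[mu]_x (energy e (usol e x))%:E <=
    \int[mu]_x (energy 0 (usol 0 x))%:E)%E.
Proof.
apply: (@le_trans _ _ (2 * sqrt_energy_int e (Num.sqrt 2))%:E).
  by rewrite energy_integral lexx.
apply: (@le_trans _ _ (2 * sqrt_energy_int 0 (Num.sqrt 2))%:E);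
  last by rewrite energy_integral lexx.
by rewrite lee_fin; apply: ler_wpM2l; [exact: ler0n|exact: sqrt_energy_int_le].
Qed.

Lemma energy_usol_integrable e :
  mu.-integrable setT (EFin \o (fun x => energy e (usol e x))).
Proof.
apply: (@integrable_ge0_finite _ _ _ (2 * sqrt_energy_int e (Num.sqrt 2))) =>
  //.
- exact: measurable_energy_usol.
- by move=> x _; exact: energy_usol_ge0.
- by rewrite energy_integral.
Qed.

End energy_integral.

(** * Convergence in H^1 *)

Section limit_profile.
Context {R : realType}.
Implicit Types (t u x y e z : R).
Notation mu := (@lebesgue_measure R).

Lemma measurable_dsol e : measurable_fun setT (dsol e).
Proof.
have ms : measurable_fun setT (fun x => sqrt_energy e (usol e x)).
  exact: (measurableT_comp (measurable_sqrt_energy e)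
    (continuous_measurable_fun (@continuous_usol R e))).
have -> : dsol e = (fun x => if x < 0 then sqrt_energy e (usol e x) else -
  sqrt_energy e (usol e x)).
  apply/funext => x; rewrite /dsol -/(sqrt_energy _ _);
    case: ltgtP => [x0|x0|->].
  - by rewrite ltr0_sg// opprK mul1r.
  - by rewrite gtr0_sg// mulN1r.
  - by rewrite sgr0 oppr0 mul0r usol0 /sqrt_energy energy_sqrt2 sqrtr0 oppr0.
apply: measurable_fun_ifT => //; last exact: measurableT_comp.
by apply: measurable_fun_ltr => //; exact: measurable_cst.
Qed.

Lemma dsol_locally_integrable e : locally_integrable setT (dsol e).
Proof.
split; [exact: measurable_dsol|exact: openT|move=> K _ cK].
have mK : measurable K by exact: compact_measurable.
have muK : (mu K < +oo)%E by exact: compact_finite_measure.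
have md := measurable_dsol e.
(* Local integrability follows from [|d| <= 1 + d^2]: [K] has finite measure and the energy is
   integrable over the line. *)
apply: (@le_lt_trans _ _
  (\int[mu]_(x in K) ((1 : R)%:E + (energy e (usol e x))%:E))%E).
  apply: ge0_le_integral => //.
  - by apply/measurable_EFinP/measurableT_comp => //; exact: measurable_funTS.
  - apply/measurable_EFinP; apply: measurable_funD => //.
    by apply: measurable_funTS; exact: measurable_energy_usol.
  move=> x _; rewrite -EFinD lee_fin -dsol_sqr
    -(real_normK (num_real (dsol e x))).
  by have := sqr_ge0 (`|dsol e x| - 1); nra.
rewrite ge0_integralD//; last 2 first.
- by move=> x _; rewrite lee_fin energy_usol_ge0.
- by apply/measurable_EFinP; apply: measurable_funTS;
  exact: measurable_energy_usol.
rewrite integral_cst// mul1e lte_add_pinfty//.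
apply: (@le_lt_trans _ _ (\int[mu]_x (energy e (usol e x))%:E)%E).
  apply: ge0_subset_integral => //.
  - by apply/measurable_EFinP; exact: measurable_energy_usol.
  - by move=> x _; rewrite lee_fin energy_usol_ge0.
by rewrite energy_integral ltry.
Qed.

Lemma stretch_param_gt0 e x : x \notin [:: crest e; - crest e] ->
  0 < stretch e (param e x).
Proof.
move=> xs; apply: stretch_gt0; apply: denom0_gt0; first exact: sech_prof_gt0.
exact: usol_neq1 xs.
Qed.

Lemma weak_derivative_usolB e : weak_derivative (fun x => usol e x - usol 0 x)
  (fun x => dsol e x - dsol 0 x).
Proof.
pose s : seq R := [:: crest e; - crest e] ++ [:: crest 0; - crest 0].
have hs x : x \notin s -> 0 < stretch e (param e x) /\
  0 < stretch 0 (param 0 x).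
  rewrite mem_cat negb_or => /andP[h1 h2].
  by split; exact: stretch_param_gt0.
apply: (weak_derivative_off s).
- apply: continuous_atP => x; apply: continuous_atB; exact: continuous_usol.
- move=> x /hs[k1 k2].
  exact: (hderivB _ _ _ _ _ (is_derive_usol _ _ k1) (is_derive_usol _ _ k2)).
- by move=> x /hs[k1 k2]; apply: continuous_atB; exact: continuous_dsol.
- exact: (locally_integrableB (dsol_locally_integrable e)
  (dsol_locally_integrable 0)).
Qed.

Lemma stretch_cvg (en : nat -> R) t : en n @[n --> \oo] --> (0 : R) ->
  stretch (en n) t @[n --> \oo] --> stretch 0 t.
Proof.
move=> en0.
have c : {for (0 : R), continuous (fun e => stretch e t)}.
  have h : {for (0 : R), continuous (fun e : R => quartic t / (1 + e ^+ 2))}.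
    by continuous_rules; exact: onePsqr_neq0.
  rewrite /stretch; apply: continuous_at_sqrt; apply: continuous_atM;
    first by continuous_rules.
  by apply: continuous_at_comp; [exact: h|exact: continuous_log_ratio].
exact: (cvg_comp _ _ en0 c).
Qed.

(** * Limits along a sequence of parameters *)

Section along_sequence.
Variable en : nat -> R.
Hypotheses (en_gt0 : forall n, 0 < en n) (en_le1 : forall n, en n <= 1)
  (en_cvg : en n @[n --> \oo] --> (0 : R)).

Lemma en_sqr_le1 n : en n ^+ 2 <= 1.
Proof. by rewrite exprn_ile1// ltW. Qed.

Lemma xpos_cvg t : xpos (en n) t @[n --> \oo] --> xpos 0 t.
Proof.
wlog t0 : t / 0 <= t => [H|].
  have [t0|t0] := leP 0 t; first exact: H.
  rewrite -[t]opprK xposN.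
  under eq_fun do rewrite xposN.
  by apply: cvgN; apply: H; rewrite oppr_ge0 ltW.
rewrite /xpos primitiveE//; under eq_fun do rewrite primitiveE//.
have ik e : mu.-integrable `[0, t] (EFin \o stretch e).
  by apply: continuous_integrable_itv; exact: continuous_stretch.
have i2 : mu.-integrable `[0, t] (EFin \o (fun _ : R => 2 : R)).
  by apply: continuous_integrable_itv; exact: cst_continuous.
have h : (\int[mu]_(s in `[0%R, t]) (stretch (en n) s)%:E)%E @[n --> \oo] -->
    (\int[mu]_(s in `[0%R, t]) (stretch 0 s)%:E)%E.
  apply: (@dominated_cvg _ _ _ mu _ (measurable_itv _) _ _
    (fun _ => (2 : R)%:E)).
  - by move=> n; exact: (measurable_int mu (ik (en n))).
  - by move=> s _; apply: cvg_EFin; [exact: nearW|exact: stretch_cvg].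
  - by [].
  - exact: i2.
  - by move=> n s _; rewrite /= lee_fin ger0_norm ?stretch_ge0// stretch_le2//
    en_sqr_le1.
apply: fine_cvg; rewrite /Rintegral fineK; first exact: h.
exact: integrable_fin_num (ik 0).
Qed.

(** Pointwise convergence of increasing bijections passes to their inverses: the strict inequalities
    [xpos 0 (p - d) < x < xpos 0 (p + d)], with [p = param 0 x], persist for large [n]. *)
Lemma param_cvg x : param (en n) x @[n --> \oo] --> param 0 x.
Proof.
apply/cvgrPdist_le => d d0.
have h1 : xpos 0 (param 0 x - d) < x by rewrite -{2}(paramK 0 x) ltr_xpos
  ltrBlDr ltrDl.
have h2 : x < xpos 0 (param 0 x + d) by rewrite -{1}(paramK 0 x) ltr_xpos ltrDl.
have c1 := cvgr_lt _ (xpos_cvg (param 0 x - d)) _ h1.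
have c2 := cvgr_gt _ (xpos_cvg (param 0 x + d)) _ h2.
near=> n.
have k1 : xpos (en n) (param 0 x - d) < x by near: n; exact: c1.
have k2 : x < xpos (en n) (param 0 x + d) by near: n; exact: c2.
move: k1; rewrite -{2}(paramK (en n) x) ltr_xpos => k1.
move: k2; rewrite -{1}(paramK (en n) x) ltr_xpos => k2.
by rewrite ler_norml; move: k1 k2; move: (param 0 x) (param (en n) x) => p q;
  lra.
Unshelve. all: by end_near. Qed.

Lemma usol_cvg x : usol (en n) x @[n --> \oo] --> usol 0 x.
Proof. exact: (cvg_comp _ _ (param_cvg x) (@continuous_sech_prof R _)). Qed.

(** The positive part in Scheffe's argument. Unlike the full difference of the energies, it is
    dominated by the limit energy alone. *)
Definition defect n x : R :=
  Num.max 0 (energy 0 (usol 0 x) - energy (en n) (usol (en n) x)).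

Lemma defect_ge0 n x : 0 <= defect n x.
Proof. by rewrite /defect le_max lexx. Qed.
Lemma defect_le n x : defect n x <= energy 0 (usol 0 x).
Proof. by rewrite /defect ge_max energy_usol_ge0 gerBl energy_usol_ge0. Qed.
Lemma measurable_defect n : measurable_fun setT (defect n).
Proof.
apply: measurable_maxr; first exact: measurable_cst.
by apply: measurable_funB; exact: measurable_energy_usol.
Qed.

Lemma defect_cvg x : defect n x @[n --> \oo] --> (0 : R).
Proof.
(* Where the limit profile is [1], the convention [ln 0 = 0] makes the limit energy [0], so the
   defect is [0] for every [n]. *)
have [u1|u1] := eqVneq (usol 0 x) 1.
  have h n : defect n x = 0.
    apply/eqP; rewrite eq_le defect_ge0 andbT;
      apply: (le_trans (defect_le n x)).
    by rewrite u1 /energy expr1n subrr expr0n/= add0r mul0r ln0// oppr0 mul0r.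
  by under eq_fun do rewrite h; exact: cvg_cst.
have d0 := denom0_gt0 0 (usol 0 x) (usol_gt0 0 x) u1.
have en2 : en n ^+ 2 @[n --> \oo] --> (0 ^+ 2 : R).
  exact: (cvg_comp _ _ en_cvg (@exprn_continuous R 2 0)).
have c : energy (en n) (usol (en n) x) @[n --> \oo] --> energy 0 (usol 0 x).
  have h1 : ((1 - usol (en n) x ^+ 2) ^+ 2) @[n --> \oo] --> (1 - usol 0 x ^+ 2)
    ^+ 2.
    have hc : {for usol 0 x, continuous (fun u : R => (1 - u ^+ 2) ^+ 2)} by
      continuous_rules.
    exact: (cvg_comp _ _ (usol_cvg x) hc).
  have h2 : ((1 - usol (en n) x ^+ 2) ^+ 2 + en n ^+ 2) / (1 + en n ^+ 2)
    @[n --> \oo] -->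
      ((1 - usol 0 x ^+ 2) ^+ 2 + 0 ^+ 2) / (1 + 0 ^+ 2).
    apply: cvgM; first exact: cvgD.
    by apply: cvgV; [exact: onePsqr_neq0|apply: cvgD;
      [exact: cvg_cst|exact: en2]].
  have h3 : {for ((1 - usol 0 x ^+ 2) ^+ 2 + 0 ^+ 2) / (1 + 0 ^+ 2),
      continuous (fun y : R => - ln y / 2)}.
    continuous_rules; by rewrite divr_gt0 ?onePsqr_gt0.
  exact: (cvg_comp _ _ h2 h3).
have c2 : energy 0 (usol 0 x) - energy (en n) (usol (en n) x) @[n --> \oo] -->
  (0 : R).
  by rewrite -[X in _ --> X](subrr (energy 0 (usol 0 x))); apply: cvgB;
    [exact: cvg_cst|exact: c].
apply/cvgrPdist_le => d dp; move/cvgrPdist_le : c2 => /(_ d dp);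
  apply: filterS => n.
rewrite !sub0r !normrN => h; rewrite (ger0_norm (defect_ge0 n x)).
by rewrite /defect ge_max (ltW dp)/=; apply: le_trans h; exact: ler_norm.
Qed.

Lemma defect_integral_cvg :
  (\int[mu]_x (defect n x)%:E)%E @[n --> \oo] --> 0%E.
Proof.
have -> : 0%E = (\int[mu]_(x in [set: R]) cst (0 : \bar R) x)%E.
  by rewrite integral0_eq.
apply: (@dominated_cvg _ _ _ mu setT measurableT _ _
  (fun x => (energy 0 (usol 0 x))%:E)).
- by move=> n; apply/measurable_EFinP; exact: measurable_defect.
- by move=> x _; apply: cvg_EFin; [exact: nearW|exact: defect_cvg].
- by [].
- exact: energy_usol_integrable.
- by move=> n x _; rewrite /= lee_fin ger0_norm ?defect_ge0// defect_le.
Qed.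

Lemma sech_prof_half_integrable :
  mu.-integrable setT (EFin \o (fun x => sech_prof (x / 2) ^+ 2)).
Proof.
have cp : continuous (fun x : R => sech_prof (x / 2) ^+ 2).
  apply: continuous_atP => x; apply: continuous_atX; apply: continuous_at_comp;
    last exact: continuous_sech_prof.
  by continuous_rules.
have p0 x : 0 <= sech_prof (x / 2) ^+ 2 by exact: sqr_ge0.
have mp := continuous_measurable_fun cp.
(* [4 * tanh (x / 2)] is a primitive, and it increases by at most [8] over the line. *)
apply: (@integrable_ge0_finite _ _ _ 8) => //.
apply: (@cvge_le _ _ _ _ _ _ _ _ (cvg_integral_setT _ mp p0)).
apply: nearW => n.
have [|||||_ ->] := @ge0_FTC R [::] (fun x => sech_prof (x / 2) ^+ 2)
  (fun x => 4 * tanh (x / 2)) (- n%:R) n%:R.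
- by apply: (@le_trans _ _ 0); rewrite ?oppr_le0 ler0n.
- exact: p0.
- apply: continuous_subspaceT; apply: continuous_atP => x;
  apply: continuous_atM; first exact: continuous_at_cst.
  apply: continuous_at_comp;
    last exact: is_derive_continuous (is_derive_tanh _).
  by continuous_rules.
- move=> x _ _; apply: is_derive_hderiv.
    apply: (hderivM (fun _ => 4)); first exact: hderiv_cst.
    apply: (hderiv_comp tanh (fun y => y / 2)); first exact: is_derive_tanh.
    by apply: (hderivM (fun y => y) (fun _ => 2^-1));
      [exact: hderiv_id|exact: hderiv_cst].
  by rewrite sech_prof_sqr; field; exact: cosh_neq0.
- by move=> x _ _; exact: cp.
rewrite lee_fin mulNr /tanh sinhN coshN.
have := @tanh_le1 R (n%:R / 2); rewrite /tanh.
by move: (sinh _) (cosh _) => s c; rewrite mulNr; lra.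
Qed.

Lemma usolB_sqr_le n x : (usol (en n) x - usol 0 x) ^+ 2 <=
  sech_prof (x / 2) ^+ 2.
Proof.
have h1 := usol_le_sech_prof (en n) x (en_sqr_le1 n).
have h2 : usol 0 x <= sech_prof (x / 2) by apply: usol_le_sech_prof;
  rewrite expr0n.
have := usol_gt0 (en n) x; have := usol_gt0 0 x.
by move: (usol 0 x) (usol _ x) (sech_prof _) h1 h2 => p q r; nra.
Qed.

Lemma usolB_integral_cvg :
  (\int[mu]_x ((usol (en n) x - usol 0 x) ^+ 2)%:E)%E @[n --> \oo] --> 0%E.
Proof.
have -> : 0%E = (\int[mu]_(x in [set: R]) cst (0 : \bar R) x)%E.
  by rewrite integral0_eq.
apply: (@dominated_cvg _ _ _ mu setT measurableT _ _
  (fun x => (sech_prof (x / 2) ^+ 2)%:E)).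
- move=> n; apply/measurable_EFinP; apply: continuous_measurable_fun;
  apply: continuous_atP => x.
  by apply: continuous_atX; apply: continuous_atB; exact: continuous_usol.
- move=> x _; apply: cvg_EFin; first exact: nearW.
  have c : usol (en n) x - usol 0 x @[n --> \oo] --> (0 : R).
    by rewrite -[X in _ --> X](subrr (usol 0 x)); apply: cvgB;
      [exact: usol_cvg|exact: cvg_cst].
  have := cvg_comp _ _ c (@exprn_continuous R 2 0).
  by rewrite expr0n.
- by [].
- exact: sech_prof_half_integrable.
- by move=> n x _; rewrite /= lee_fin ger0_norm ?sqr_ge0// usolB_sqr_le.
Qed.

Lemma dsol_mul_ge0 e1 e2 x : 0 <= dsol e1 x * dsol e2 x.
Proof.
have h (g p q : R) : 0 <= p -> 0 <= q -> 0 <= (- g * p) * (- g * q).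
  move=> p0 q0; rewrite (_ : _ * _ = g ^+ 2 * (p * q)); last by ring.
  by rewrite mulr_ge0 ?sqr_ge0// mulr_ge0.
by apply: h; exact: sqrtr_ge0.
Qed.

(** With equal signs [(a - b)^2 <= |a^2 - b^2|], and [|d| = 2 * max 0 d - d] for [d = b^2 - a^2].
    Terms are arranged so that everything to be integrated is nonnegative. *)
Lemma scheffe_pointwise (a b : R) : 0 <= a * b ->
  (a - b) ^+ 2 + b ^+ 2 <=
  Num.max 0 (b ^+ 2 - a ^+ 2) + Num.max 0 (b ^+ 2 - a ^+ 2) + a ^+ 2.
Proof. by move=> ab; have [h|h] := leP 0 (b ^+ 2 - a ^+ 2); nra. Qed.

Lemma dsolB_integral_le n :
  (\int[mu]_x ((dsol (en n) x - dsol 0 x) ^+ 2)%:E <=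
   \int[mu]_x (defect n x)%:E + \int[mu]_x (defect n x)%:E)%E.
Proof.
have md e := measurable_dsol e.
have me e : measurable_fun setT (fun x => (energy e (usol e x))%:E).
  by apply/measurable_EFinP; exact: measurable_energy_usol.
have m1 : measurable_fun setT (fun x => ((dsol (en n) x - dsol 0 x) ^+ 2)%:E).
  by apply/measurable_EFinP; apply: measurable_funX; exact: measurable_funB.
have m2 : measurable_fun setT (fun x => (defect n x)%:E).
  by apply/measurable_EFinP; exact: measurable_defect.
have fin0 : (\int[mu]_x (energy 0 (usol 0 x))%:E)%E \is a fin_num.
  by rewrite energy_integral.
(* Adding the finite integral of the limit energy to both sides avoids subtraction in [\bar R]; on
   the right it absorbs the integral of the energy at [en n], by [energy_integral_le]. *)
rewrite -(leeD2rE _ _ fin0).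
have p1 x : (0 <= ((dsol (en n) x - dsol 0 x) ^+ 2)%:E)%E by rewrite lee_fin
  sqr_ge0.
have p2 e x : (0 <= (energy e (usol e x))%:E)%E by rewrite lee_fin
  energy_usol_ge0.
have p3 x : (0 <= (defect n x)%:E)%E by rewrite lee_fin defect_ge0.
rewrite -ge0_integralD//; last exact: me.
apply: (@le_trans _ _ (\int[mu]_x (((defect n x)%:E + (defect n x)%:E) +
    (energy (en n) (usol (en n) x))%:E))%E).
  apply: ge0_le_integral; first exact: measurableT.
  - by move=> x _; apply: adde_ge0; [exact: p1|exact: p2].
  - by apply: emeasurable_funD; [exact: m1|exact: me].
  - by apply: emeasurable_funD; [apply: emeasurable_funD|];
    [exact: m2|exact: m2|exact: me].
  move=> x _; rewrite -!EFinD lee_fin -!dsol_sqr /defect -!dsol_sqr.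
  exact/scheffe_pointwise/dsol_mul_ge0.
have i1 : (\int[mu]_x (((defect n x)%:E + (defect n x)%:E) +
      (energy (en n) (usol (en n) x))%:E) =
    \int[mu]_x ((defect n x)%:E + (defect n x)%:E) +
      \int[mu]_x (energy (en n) (usol (en n) x))%:E)%E.
  apply: ge0_integralD; first exact: measurableT.
  - by move=> x _; apply: adde_ge0; exact: p3.
  - by apply: emeasurable_funD; exact: m2.
  - by move=> x _; exact: p2.
  - exact: me.
have i2 : (\int[mu]_x ((defect n x)%:E + (defect n x)%:E) =
    \int[mu]_x (defect n x)%:E + \int[mu]_x (defect n x)%:E)%E.
  apply: ge0_integralD; first exact: measurableT.
  - by move=> x _; exact: p3.
  - exact: m2.
  - by move=> x _; exact: p3.
  - exact: m2.
rewrite i1 i2; apply: leeD; first exact: lexx.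
exact: energy_integral_le.
Qed.

Lemma H1_norm_ge0 (f : R -> R) : (0 <= H1_norm f)%E.
Proof. by apply: le_ereal_inf_tmp => _ [g _ <-]; exact: sqrte_ge0. Qed.

Lemma sqrte_cvg0 (z : nat -> \bar R) : z n @[n --> \oo] --> 0%E ->
  sqrte (z n) @[n --> \oo] --> 0%E.
Proof.
move=> /fine_cvgP[zfin z0].
have c : (Num.sqrt (fine (z n)))%:E @[n --> \oo] --> (Num.sqrt 0)%:E.
  apply: cvg_EFin; first exact: nearW.
  exact: (cvg_comp _ _ z0 (@sqrt_continuous R 0)).
rewrite sqrtr0 in c; apply: cvg_trans c; apply: near_eq_cvg.
apply: filterS zfin => n; by case: (z n).
Qed.

(** The infimum in [H1_norm] is bounded above by exhibiting the weak derivative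
    [dsol (en n) - dsol 0]; the resulting bound tends to [0]. *)
Lemma H1_norm_cvg :
  H1_norm (fun x => usol (en n) x - usol 0 x) @[n --> \oo] --> 0%E.
Proof.
apply: (@squeeze_cvge _ _ _ _ (cst 0%E) _ (fun n => sqrte
    (\int[mu]_x ((usol (en n) x - usol 0 x) ^+ 2)%:E +
     (\int[mu]_x (defect n x)%:E + \int[mu]_x (defect n x)%:E))%E)).
- apply: nearW => n; rewrite H1_norm_ge0/=.
  apply: ge_ereal_inf; eexists.
    by exists (fun x => dsol (en n) x - dsol 0 x);
      [exact: weak_derivative_usolB|reflexivity].
  rewrite lee_sqrt; first by apply: leeD2l; exact: dsolB_integral_le.
  have dI : (0 <= \int[mu]_x (defect n x)%:E)%E.
    by apply: integral_ge0 => x _; rewrite lee_fin defect_ge0.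
  apply: adde_ge0; last exact: adde_ge0.
  by apply: integral_ge0 => x _; rewrite lee_fin sqr_ge0.
- exact: cvg_cst.
- apply: sqrte_cvg0; rewrite -[0%E]adde0 -{2}[0%E]adde0.
  apply: cvgeD => //; first exact: usolB_integral_cvg.
  by apply: cvgeD => //; exact: defect_integral_cvg.
Qed.

End along_sequence.

End limit_profile.

Theorem proposition4 (R : realType) :
  (forall eps : R, 0 < eps ->
     exists u : R -> R, solitary_wave eps u /\
       forall v : R -> R, solitary_wave eps v ->
         exists a : R, forall x : R, v x = u (x - a)) /\
  (forall u : R -> R -> R,
     (forall eps : R, 0 < eps ->
        solitary_wave eps (u eps) /\ forall x : R, u eps x <= u eps 0) ->
     H1_norm (fun x : R => u eps x - bell_soliton x) @[eps --> 0^'+]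
       --> (0%:E : \bar R)).
Proof.
split=> [eps eps0|u hu].
  exists (usol eps); split; first exact: usol_wave.
  move=> v hv; have [a ha] := wave_max eps v hv.
  by exists a; exact: (wave_eq_usol eps v eps0 hv).
have E eps : 0 < eps -> (fun x => u eps x - bell_soliton x) =
    (fun x => usol eps x - usol 0 x).
  move=> eps0; have [hw hm] := hu eps eps0; apply/funext => x.
  by rewrite bell_solitonE (wave_eq_usol eps (u eps) eps0 hw 0 hm) subr0.
apply/cvge_at_rightP => en [en0 enc].
(* The uniform bounds require parameters at most [1]; the cap changes only finitely many terms. *)
pose e1 n := Num.min (en n) 1.
have e1_0 n : 0 < e1 n by rewrite lt_min en0 ltr01.
have e1_1 n : e1 n <= 1 by rewrite ge_min lexx orbT.
have eq1 : \forall n \near \oo, e1 n = en n.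
  near=> n; rewrite /e1 min_l//; apply: ltW.
  by near: n; exact: (cvgr_lt _ enc).
have e1c : e1 n @[n --> \oo] --> (0 : R).
  by apply: cvg_trans enc; apply: near_eq_cvg; apply: filterS eq1.
apply: cvg_trans (H1_norm_cvg e1 e1_0 e1_1 e1c); apply: near_eq_cvg.
by apply: filterS eq1 => n ->; rewrite E.
Unshelve. all: by end_near. Qed.
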